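(* Let $\ell\ge 1$ and let $P_1,\dots,P_\ell\in\mathbb{Z}[d]$ be polynomials with integer coefficients satisfying $P_i(0)=0$ for $i=1,\dots,\ell$, and suppose that $k:=\max_{1\le i\le \ell}\deg P_i\geq 2$. Then there exists a constant $C'=C'(P_1,\dots,P_\ell)>0$ such that the following holds for every integer $N\ge 3$. If $A,B\subseteq\{1,\dots,N\}$ and there are no integers $d\neq 0$ and $m\in\{2,\dots,2N\}$ with $$m+\{P_1(d),\dots,P_\ell(d)\}\subseteq A+B,$$ then $$\frac{|A||B|}{N^2}\leq C'\left(\frac{\log\log N}{\log N}\right)^{1/(\ell(k-1))}.$$
   Context: For $A,B\subseteq\mathbb{Z}$, $A+B=\{a+b : a\in A,\ b\in B\}$ denotes the sumset, and $m+X=\{m+x: x\in X\}$. *)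

(* Defs.v *)
From HB Require Import structures.
From mathcomp Require Import all_boot all_order all_algebra.
From mathcomp Require Import finmap.
From mathcomp Require Import reals exp.

Set Implicit Arguments.
Unset Strict Implicit.
Unset Printing Implicit Defensive.

Local Open Scope fset_scope.
Local Open Scope ring_scope.

Definition sumset (A B : {fset int}) : {fset int} :=
  [fset a + b | a in A, b in B].

Definition translate (m : int) (X : {fset int}) : {fset int} :=
  [fset m + x | x in X].

Definition poly_values (l : nat) (P : 'I_l -> {poly int}) (d : int) :
    {fset int} :=
  [fset (P i).[d] | i in 'I_l].

(* With [(size p).-1] as degree the zero polynomial counts as degree 0, which
   does not affect the maximum when it is at least 2. *)
Definition max_degree (l : nat) (P : 'I_l -> {poly int}) : nat :=
  (\max_(i < l) (size (P i)).-1)%N.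

(* Main.v *)
(* With f = 1_A * 1_B on Z/4N, a configuration exists as soon as the shift of f by
   P_i(d) is close to f in l^2 for every i, since then some x has f(x) > 0 and
   f(x + P_i(d)) > 0 for all i. By Parseval only the large spectrum of A matters,
   which has r = O(N^2 / |A||B|) elements, so it suffices to find d > 0 for which
   all d^j xi / 4N, j <= k, are within a constant of an integer for xi in the
   spectrum. Such a d <= D exists once D >= (E r)^(E r^2), a form of Schmidt's
   theorem: if the average over d <= D of a positive kernel supported near 0 is
   small, some combination of the frequencies has a large Weyl sum, hence becomes
   almost trivial on multiples of a bounded q; replacing d by q d and repeating,
   all combinations are covered after k r steps, each costing a factor
   exp(O(r log r)). This yields |A||B|/N^2 = O((loglog N / log N)^(1/2)). *)

Require Import Defs.
From HB Require Import structures.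
From mathcomp Require Import all_boot all_order all_algebra.
From mathcomp Require Import finmap.
From mathcomp Require Import reals exp.
From mathcomp Require Import perm cyclic separable cyclotomic boolp sequences complex.
From mathcomp Require Import zify ring lra.

Set Implicit Arguments.
Unset Strict Implicit.
Unset Printing Implicit Defensive.

Import Order.TTheory GRing.Theory Num.Theory.
Local Open Scope fset_scope.
Local Open Scope ring_scope.

(** * Unit complex numbers *)

(** The cost [exp(O(r log r))] of a step has two sources. The kernel is a power with exponent [h] of
    order [r ^ 2], so its expansion has [h.+1 ^ (k * r)] terms; the diagonal contributes only the
    inverse of that number, and every other sum must be known to a precision [1 / T] with [ln T] of
    order [r ln r]. Moreover, combinations of frequencies already treated are reached only through
    Cramer's rule, whose determinants are bounded by [r! h ^ r]. Polynomial dependence on [T] in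
    Weyl's inequality is thus harmless, and crude differencing suffices. The obstacle is to keep the
    losses of successive steps multiplicative. Each failure supplies, in some degree, a frequency
    vector independent of the earlier ones, so ranks limit their number to [k * r]; and one
    determinant, fixed before the combination is known, must serve a whole span at once. With [ln N]
    of order [r ^ 2 ln r] and density of order [1 / r], the exponent 1/2 comes out. *)

Section ComplexNorm.
Variable R : rcfType.
Implicit Types x y z : R[i].

Definition cnorm (z : R[i]) : R := complex.Re `|z|.

Lemma cnormE z : (cnorm z)%:C%C = `|z|.
Proof. by rewrite /cnorm normc_def. Qed.

Lemma cnorm_ge0 z : 0 <= cnorm z.
Proof. by rewrite -lecR cnormE normr_ge0. Qed.

Lemma cnorm0 : cnorm 0 = 0.
Proof. by apply: complexI; rewrite cnormE normr0. Qed.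

Lemma cnorm1 : cnorm 1 = 1.
Proof. by apply: complexI; rewrite cnormE normr1. Qed.

Lemma cnormM x y : cnorm (x * y) = cnorm x * cnorm y.
Proof. by apply: complexI; rewrite rmorphM /= !cnormE normrM. Qed.

Lemma cnormX x n : cnorm (x ^+ n) = cnorm x ^+ n.
Proof. by apply: complexI; rewrite rmorphXn /= !cnormE normrX. Qed.

Lemma cnormV x : cnorm x^-1 = (cnorm x)^-1.
Proof. by apply: complexI; rewrite fmorphV /= !cnormE normfV. Qed.

Lemma cnormN x : cnorm (- x) = cnorm x.
Proof. by rewrite /cnorm normrN. Qed.

Lemma cnorm_conj x : cnorm (x^*)%C = cnorm x.
Proof. by rewrite /cnorm normcJ. Qed.

Lemma cnorm_nat n : cnorm n%:R = n%:R.
Proof. by apply: complexI; rewrite cnormE normr_nat rmorph_nat. Qed.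

Lemma cnormD x y : cnorm (x + y) <= cnorm x + cnorm y.
Proof. by rewrite -lecR rmorphD /= !cnormE ler_normD. Qed.

Lemma cnormB x y : cnorm (x - y) <= cnorm x + cnorm y.
Proof. by rewrite -(cnormN y) cnormD. Qed.

Lemma cnorm_distC x y : cnorm (x - y) = cnorm (y - x).
Proof. by rewrite /cnorm distrC. Qed.

Lemma cnorm_sum (I : Type) (r : seq I) (P : pred I) (F : I -> R[i]) :
  cnorm (\sum_(i <- r | P i) F i) <= \sum_(i <- r | P i) cnorm (F i).
Proof.
elim/big_rec2: _ => [|i y x _ le]; first by rewrite cnorm0.
by rewrite (le_trans (cnormD _ _)) // lerD2l.
Qed.

Lemma cnorm_prod (I : Type) (r : seq I) (P : pred I) (F : I -> R[i]) :
  cnorm (\prod_(i <- r | P i) F i) = \prod_(i <- r | P i) cnorm (F i).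
Proof. by apply: (big_morph cnorm cnormM cnorm1). Qed.

Lemma unit_neq0 z : cnorm z = 1 -> z != 0.
Proof. by move=> z1; apply: contra_eq_neq z1 => ->; rewrite cnorm0 eq_sym oner_eq0. Qed.

Lemma cnorm_unitX z n : cnorm z = 1 -> cnorm (z ^+ n) = 1.
Proof. by move=> z1; rewrite cnormX z1 expr1n. Qed.

Lemma cnorm_unitV z : cnorm z = 1 -> cnorm z^-1 = 1.
Proof. by move=> z1; rewrite cnormV z1 invr1. Qed.

Lemma cnorm_unitM x y : cnorm x = 1 -> cnorm y = 1 -> cnorm (x * y) = 1.
Proof. by move=> x1 y1; rewrite cnormM x1 y1 mulr1. Qed.

Lemma cnorm_unitz z (n : int) : cnorm z = 1 -> cnorm (z ^ n) = 1.
Proof.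
by move=> z1; case: n => n; rewrite /exprz ?cnormV cnorm_unitX // invr1.
Qed.

Lemma conj_unit z : cnorm z = 1 -> (z^*)%C = z^-1.
Proof. by move=> z1; rewrite invc_norm -cnormE z1 expr1n invr1 mul1r. Qed.

(** Stands in for the distance of an angle to the nearest integer; being algebraic, it makes sense
    over any real closed field. *)
Definition udist z := cnorm (z - 1).

Lemma udist_ge0 z : 0 <= udist z. Proof. exact: cnorm_ge0. Qed.

Lemma udist1 : udist 1 = 0. Proof. by rewrite /udist subrr cnorm0. Qed.

Lemma udist_le2 z : cnorm z = 1 -> udist z <= 2.
Proof. by move=> z1; have := cnormB z 1; rewrite z1 cnorm1. Qed.

Lemma udistM x y : cnorm x = 1 -> udist (x * y) <= udist x + udist y.
Proof.
move=> x1; rewrite /udist (_ : x * y - 1 = (x - 1) + x * (y - 1)); last by ring.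
by rewrite (le_trans (cnormD _ _)) // cnormM x1 mul1r.
Qed.

Lemma udistX x n : cnorm x = 1 -> udist (x ^+ n) <= n%:R * udist x.
Proof.
move=> x1; elim: n => [|n IH]; first by rewrite expr0 udist1 mul0r.
by rewrite exprS (le_trans (udistM _ x1)) // -natr1 mulrDl mul1r addrC lerD2r.
Qed.

Lemma udistV x : cnorm x = 1 -> udist x^-1 = udist x.
Proof.
move=> x1; have x0 := unit_neq0 x1.
rewrite /udist -[RHS]mul1r -(cnorm_unitV x1) -cnormM mulrBr mulVf // mulr1.
exact: cnorm_distC.
Qed.

Lemma udist_div x y : cnorm y = 1 -> udist (x / y) = cnorm (x - y).
Proof.
move=> y1; have y0 := unit_neq0 y1.
by rewrite /udist -[LHS]mulr1 -[in LHS]y1 -cnormM mulrBl mul1r divfK.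
Qed.

Lemma udist_exprz x (n : int) : cnorm x = 1 -> udist (x ^ n) <= `|n|%:R * udist x.
Proof.
move=> x1; case: n => n; rewrite /exprz ?udistX //.
by rewrite udistV ?cnorm_unitX // NegzE /= udistX.
Qed.

Lemma udist_prod (I : Type) (r : seq I) (P : pred I) (F : I -> R[i]) :
  (forall i, P i -> cnorm (F i) = 1) ->
  udist (\prod_(i <- r | P i) F i) <= \sum_(i <- r | P i) udist (F i).
Proof.
move=> F1; elim: r => [|i r IH]; first by rewrite !big_nil udist1.
rewrite !big_cons; case: ifP => // Pi.
by rewrite (le_trans (udistM _ (F1 _ Pi))) // lerD2l.
Qed.

(** Converse of [udistX] as long as the powers cannot wrap around the circle. Factor [z ^+ n - 1]
    through the geometric sum; pairing [i] with [n - 1 - i] shows that its terms are on average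
    within 1/2 of 1, so the sum has norm at least [n / 2]. *)
Lemma udist_expr_lower z n : cnorm z = 1 -> n%:R * udist z <= 1 ->
  n%:R * udist z <= 2 * udist (z ^+ n).
Proof.
move=> z1 small; rewrite {2}/udist subrX1 cnormM -/(udist z).
have : n%:R <= 2 * cnorm (\sum_(i < n) z ^+ i).
  have : cnorm (\sum_(i < n) (1 - z ^+ i)) <= n%:R / 2.
    apply: (le_trans (cnorm_sum _ _ _)).
    have -> : n%:R / 2 = \sum_(i < n) (1 / 2 : R).
      by rewrite sumr_const card_ord -[RHS]mulr_natl; field.
    pose G (i : 'I_n) : R := i%:R * udist z.
    have le1 : \sum_(i < n) cnorm (1 - z ^+ i) <= \sum_i G i.
      by apply: ler_sum => i _; rewrite cnorm_distC udistX.
    have rv : \sum_i G i = \sum_i G (rev_ord i).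
      by rewrite (reindex_inj rev_ord_inj).
    have : \sum_i G i + \sum_i G (rev_ord i) <= \sum_(i < n) 1.
      rewrite -big_split /=; apply: ler_sum => i _.
      rewrite /G /= -mulrDl -natrD (le_trans _ small) //.
      by rewrite ler_wpM2r ?udist_ge0 // ler_nat; case: i => i /=; lia.
    rewrite -rv sumr_const card_ord => le2.
    rewrite sumr_const card_ord -[X in _ <= X]mulr_natl.
    rewrite -[X in _ <= X]mulr_natl in le2; lra.
  rewrite sumrB sumr_const card_ord => le.
  have := cnormD (n%:R - \sum_(i < n) z ^+ i) (\sum_(i < n) z ^+ i).
  rewrite subrK cnorm_nat; lra.
have := udist_ge0 z; nra.
Qed.

End ComplexNorm.

(** * Return times *)

Lemma pigeonhole (T : eqType) (S : seq T) (f : T -> nat) (K n : nat) :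
  {in S, forall h, f h < K}%N -> (K * n < size S)%N ->
  exists c, (c < K)%N /\ (n < size [seq h <- S | f h == c])%N.
Proof.
move=> fK big.
have [/existsP[c lt_c]|/existsPn no] :=
    boolP [exists c : 'I_K, (n < size [seq h <- S | f h == c])%N].
  by exists c.
suff : (size S <= K * n)%N by rewrite leqNgt big.
have -> : size S = (\sum_(c < K) size [seq h <- S | f h == c])%N.
  elim: S fK {big no} => [|h S IH] fK /=; first by rewrite big1.
  have h_lt : (f h < K)%N by rewrite fK // mem_head.
  rewrite IH => [|x xS]; last by rewrite fK // in_cons xS orbT.
  rewrite (bigD1 (Ordinal h_lt)) //= [RHS](bigD1 (Ordinal h_lt)) //= eqxx /=.
  rewrite -addSn; congr (_ + _)%N; apply: eq_bigr => i ne.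
  by case: eqP => // e; case/eqP: ne; apply: val_inj; rewrite /= e.
rewrite -[K in (K * n)%N]card_ord -sum_nat_const; apply: leq_sum => c _.
by rewrite leqNgt no.
Qed.

Lemma spread_of_uniq (S : seq nat) (n : nat) :
  uniq S -> (n < size S)%N -> exists x y, [/\ x \in S, y \in S & (x + n <= y)%N].
Proof.
move=> uS big.
have ex : exists x, x \in S by case: S big {uS} => // x S _; exists x; rewrite mem_head.
case: (ex_minnP ex) => x xS xmin.
have [/hasP[y yS le]|/hasPn no] := boolP (has (fun y => x + n <= y)%N S).
  by exists x, y.
suff : (size S <= size (iota x n))%N by rewrite size_iota leqNgt big.
apply: uniq_leq_size => // y yS.
by rewrite mem_iota xmin // ltnNge no.
Qed.

Lemma leq_double_divM (X q : nat) : (0 < q <= X -> X <= 2 * q * (X %/ q))%N.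
Proof.
case/andP=> q0 qX; have : (0 < X %/ q)%N by rewrite divn_gt0.
move: (divn_eq X q) (ltn_pmod X q0); move: (X %/ q)%N (X %% q)%N => u v.
by nia.
Qed.

Section Recurrence.
Variable R : rcfType.
Implicit Types z : R[i].

Lemma udist_expr_sub z (a b : nat) (e : R) : cnorm z = 1 -> (a <= b)%N ->
  udist (z ^+ a) <= e -> udist (z ^+ b) <= e -> udist (z ^+ (b - a)) <= 2 * e.
Proof.
move=> z1 le_ab ea eb; rewrite expfB_cond; last by rewrite (negPf (unit_neq0 z1)).
have := udistM (z ^+ a)^-1 (cnorm_unitX b z1).
by rewrite udistV ?cnorm_unitX //; lra.
Qed.

Section Vinogradov.
Variables (z : R[i]) (s X : nat) (S : seq nat) (e : R).
Hypotheses (z1 : cnorm z = 1) (uS : uniq S)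
  (SX : {in S, forall h, 0 < h <= X}%N) (X_gt0 : (0 < X)%N)
  (dense : (X <= s * size S)%N) (Se : {in S, forall h, udist (z ^+ h) <= e}).

(** Two elements of [S] in one residue class mod [q], with quotients in one block of length [J],
    differ by [q * m] with [m <= J]. There are at most [2 * X / J] such classes and [S] has density
    [1 / s], so for [J > 2 * n * s] one class has more than [n] elements, and its extreme quotients
    are at least [n] apart. *)
Lemma block_return (q J n : nat) : (0 < q)%N -> (0 < J)%N -> (q * J <= X)%N ->
  (2 * n * s < J)%N -> exists m, (n <= m <= J)%N /\ udist (z ^+ (q * m)) <= 2 * e.
Proof.
move=> q0 J0 qJX nJ.
pose f h := (h %% q + q * (h %/ q %/ J))%N.
pose K := (q * (X %/ q %/ J).+1)%N.
have fK : {in S, forall h, f h < K}%N.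
  move=> h /SX/andP[_ hX]; rewrite /f /K mulnS.
  apply: leq_trans (_ : q + q * (h %/ q %/ J) <= _)%N.
    by rewrite ltn_add2r ltn_mod.
  by rewrite leq_add2l leq_mul2l !leq_div2r ?orbT.
have Kn : (K * n < size S)%N.
  have KJ : (K * J <= 2 * X)%N.
    rewrite /K -divnMA; have := leq_divM X (q * J); nia.
  have S0 : (0 < size S)%N by nia.
  rewrite ltnNge; apply/negP => le.
  have le1 : (size S * J <= 2 * X * n)%N.
    by apply: leq_trans (leq_mul le (leqnn J)) _; rewrite mulnAC leq_mul2r KJ orbT.
  have le2 : (2 * X * n <= 2 * n * s * size S)%N by nia.
  have : (2 * n * s * size S < J * size S)%N by rewrite ltn_pmul2r.
  by rewrite ltnNge (leq_trans _ le2) // mulnC.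
have [c [_ big]] := pigeonhole fK Kn.
set S' := [seq h <- S | f h == c] in big.
have S'P h : h \in S' -> [/\ h \in S, h %% q = c %% q & h %/ q %/ J = c %/ q]%N.
  rewrite mem_filter => /andP[/eqP <- hS]; split=> //.
    by rewrite /f addnC mulnC modnMDl modn_mod.
  by rewrite /f addnC mulnC divnMDl // (divn_small (ltn_pmod h q0)) addn0.
have u' : uniq (map (divn^~ q) S').
  rewrite map_inj_in_uniq ?filter_uniq // => x y /S'P[_ xq _] /S'P[_ yq _] xy.
  by rewrite (divn_eq x q) (divn_eq y q) xy xq yq.
have [|x [y [/mapP[a aS' xa] /mapP[b bS' yb] xy]]] := @spread_of_uniq _ n u'.
  by rewrite size_map.
have [aS aq aJ] := S'P _ aS'; have [bS bq bJ] := S'P _ bS'.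
exists (y - x)%N; split.
  have xJ : (x %/ J = c %/ q)%N by rewrite xa.
  have yJ : (y %/ J = c %/ q)%N by rewrite yb.
  move: (divn_eq x J) (divn_eq y J) (ltn_pmod x J0) (ltn_pmod y J0).
  rewrite xJ yJ; move: (x %% J)%N (y %% J)%N (c %/ q)%N => u v t.
  by clear -xy; lia.
have -> : (q * (y - x) = b - a)%N.
  move: (divn_eq a q) (divn_eq b q); rewrite aq bq -xa -yb => -> ->.
  by rewrite subnDr -mulnBl mulnC.
apply: udist_expr_sub; rewrite ?Se //.
by rewrite (divn_eq a q) (divn_eq b q) aq bq leq_add2r leq_mul2r -xa -yb (leq_trans (leq_addr n x) xy) orbT.
Qed.

(** Blocks of length [2 * s] covering the range are fewer than the elements of [S], so two elements
    share a block. *)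
Lemma short_return : exists q, (0 < q <= 2 * s)%N /\ udist (z ^+ q) <= 2 * e.
Proof.
have [small|large] := ltnP X (2 * s).
  have : (0 < size S)%N by nia.
  case: S SX Se => // h S' SX' Se' _; have hS := mem_head h S'; exists h.
  have := SX' _ hS; have := Se' _ hS; have := udist_ge0 (z ^+ h); split; [lia|lra].
pose K := ((X - 1) %/ (2 * s)).+1.
have s0 : (0 < s)%N by case: (s) dense X_gt0 => //; rewrite mul0n; lia.
have fK : {in S, forall h, (h - 1) %/ (2 * s) < K}%N.
  by move=> h /SX/andP[_ hX]; rewrite ltnS leq_div2r // leq_sub2r.
have Kn : (K * 1 < size S)%N.
  have := leq_divM (X - 1) (2 * s); rewrite /K; nia.
have [c [_ big]] := pigeonhole fK Kn.
set S' := [seq h <- S | _] in big.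
have [x [y [xS yS xy]]] := spread_of_uniq (filter_uniq _ uS : uniq S') big.
move: xS yS; rewrite !mem_filter => /andP[/eqP xc xS] /andP[/eqP yc yS].
exists (y - x)%N; split; last by apply: udist_expr_sub; rewrite ?Se //; lia.
have := SX xS; have := SX yS.
have s20 : (0 < 2 * s)%N by lia.
have := divn_eq (x - 1) (2 * s); have := divn_eq (y - 1) (2 * s).
have := ltn_pmod (x - 1) s20; have := ltn_pmod (y - 1) s20.
by rewrite xc yc; lia.
Qed.

(** A dense set of return times improves the error [e] by a factor of order [X]. As long as
    [J * y <= 1], [block_return] and [udist_expr_lower] sharpen this to [J * y <= 32 * s * e], which
    is below 1/2 by the hypothesis on [e]; so [J] may be raised by one, again and again, up to
    [X %/ q]. *)
Lemma vinogradov : 64 * s%:R * e < 1 ->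
  exists q, (0 < q <= 2 * s)%N /\ udist (z ^+ q) * X%:R <= 128 * s%:R ^+ 2 * e.
Proof.
move=> small; have [q [/andP[q0 q2s] qe]] := short_return.
exists q; split; first by rewrite q0.
set y := udist (z ^+ q) in qe *.
have y0 : 0 <= y := udist_ge0 _.
have s1 : 1 <= s%:R :> R by rewrite ler1n; lia.
have qs : q%:R <= 2 * s%:R :> R by rewrite -natrM ler_nat.
have step J : (4 * s <= J)%N -> (q * J <= X)%N -> J%:R * y <= 1 ->
    J%:R * y <= 32 * s%:R * e.
  move=> sJ qJ Jy.
  have s0 : (0 < 4 * s)%N by lia.
  have [||m [/andP[le_m mJ] me]] := @block_return q J (J %/ (4 * s)) q0 _ qJ; first by lia.
    by have := leq_divM J (4 * s); nia.
  have my : m%:R * y <= 4 * e.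
    have mJR : m%:R <= J%:R :> R by rewrite ler_nat.
    have := @udist_expr_lower R (z ^+ q) m (cnorm_unitX _ z1).
    rewrite -/y -exprM => /(_ _); have /[swap]/[apply] : m%:R * y <= 1 by nra.
    lra.
  have Jm : J%:R <= 8 * s%:R * m%:R :> R.
    rewrite -!natrM ler_nat.
    by rewrite (leq_trans (@leq_double_divM J (4 * s) _)) ?s0 ?sJ // !mulnA leq_mul2l le_m orbT.
  nra.
have X0 : 0 <= X%:R :> R by [].
(* Few multiples of [q] mean [X <= 8 * s ^ 2], and then [y <= 2 * e] from [short_return] is
   enough. *)
have [few|many] := ltnP (X %/ q) (4 * s).
  have : X%:R <= 8 * s%:R ^+ 2 :> R.
    rewrite -natrX -natrM ler_nat.
    move: (divn_eq X q) (ltn_pmod X q0) few; move: (X %/ q)%N (X %% q)%N => u v.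
    by clear -q2s; nia.
  nra.
have all_J i : (4 * s + i <= X %/ q)%N -> (4 * s + i)%:R * y <= 32 * s%:R * e.
  have qX := leq_divM X q.
  elim: i => [|i IH] le.
    apply: step; [lia|nia|].
    by rewrite natrD natrM; nra.
  apply: step; [lia|nia|].
  have /IH {}IH : (4 * s + i <= X %/ q)%N by lia.
  by rewrite addnS -natr1 mulrDl; nra.
have := all_J (X %/ q - 4 * s)%N; rewrite subnKC // => /(_ (leqnn _)).
have : X%:R <= 2 * q%:R * (X %/ q)%:R :> R.
  rewrite -!natrM ler_nat leq_double_divM // q0.
  by have := leq_divM X q; nia.
have e0 : 0 <= e by lra.
set t := (X %/ q)%:R => Xt ty.
have yX : y * X%:R <= 2 * q%:R * (32 * s%:R * e).
  apply: le_trans (_ : 2 * q%:R * (t * y) <= _).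
    by rewrite mulrC [X in _ <= X]mulrA ler_wpM2r.
  by rewrite ler_wpM2l ?mulr_ge0.
have : 2 * q%:R * (32 * s%:R * e) <= 4 * s%:R * (32 * s%:R * e).
  by rewrite ler_wpM2r ?mulr_ge0 //; lra.
lra.
Qed.

End Vinogradov.
End Recurrence.

(** * Weyl sums *)

(** Later [T] is exponential in [r ln r], a size that polynomial losses preserve; so constants and
    exponents are not tracked, and one [C] plays both roles. *)
Definition poly_bounded (f : nat -> nat) :=
  exists C, forall T, (0 < T -> f T <= C * T ^ C)%N.

Lemma poly_bounded_const c : poly_bounded (fun=> c).
Proof. by exists c => T T0; rewrite leq_pmulr // expn_gt0 T0. Qed.

Lemma poly_bounded_id : poly_bounded id.
Proof. by exists 1%N => T _; rewrite mul1n expn1. Qed.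

Lemma poly_boundedM f g :
  poly_bounded f -> poly_bounded g -> poly_bounded (fun T => f T * g T)%N.
Proof.
case=> C fC [D gD]; exists (C * D + (C + D))%N => T T0.
apply: leq_trans (leq_mul (fC _ T0) (gD _ T0)) _.
rewrite mulnACA -expnD leq_mul ?leq_addr // leq_pexp2l //; lia.
Qed.

Lemma poly_boundedD f g :
  poly_bounded f -> poly_bounded g -> poly_bounded (fun T => f T + g T)%N.
Proof.
case=> C fC [D gD]; exists (C + D)%N => T T0.
apply: leq_trans (leq_add (fC _ T0) (gD _ T0)) _.
by rewrite mulnDl leq_add // leq_mul2l leq_pexp2l ?orbT // (leq_addr, leq_addl).
Qed.

Lemma poly_boundedX f n :
  poly_bounded f -> poly_bounded (fun T => f T ^ n)%N.
Proof.
move=> pf; elim: n => [|n IH]; first exact: poly_bounded_const.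
by have [C fC] := poly_boundedM pf IH; exists C => T T0; rewrite expnS fC.
Qed.

Lemma poly_bounded_comp f g : (forall T, 0 < T -> 0 < g T)%N ->
  poly_bounded f -> poly_bounded g -> poly_bounded (f \o g).
Proof.
move=> g0 [C fC] pg.
have [D gD] := poly_boundedM (poly_bounded_const C) (poly_boundedX C pg).
by exists D => T T0; apply: leq_trans (fC _ (g0 _ T0)) (gD _ T0).
Qed.

Section Weyl.
Variable R : rcfType.
Implicit Types (a b : R[i]) (phi : nat -> R[i]).

(* In additive notation, [phi] is a polynomial of degree at most [k] modulo 1
   and [a] is [k!] times its leading coefficient. *)
Fixpoint phase k a phi : Prop :=
  if k is k'.+1 then forall h, phase k' (a ^+ h) (fun x => phi (x + h)%N / phi x)
  else forall x, phi x = a.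

Lemma eq_phase k a phi psi : phi =1 psi -> phase k a phi -> phase k a psi.
Proof.
elim: k a phi psi => [|k IH] a phi psi e /=; first by move=> + x; rewrite -e.
by move=> ph h; apply: IH (ph h) => x; rewrite !e.
Qed.

Lemma phase_shift k a phi c : phase k a phi -> phase k a (fun x => phi (x + c)%N).
Proof.
elim: k a phi => [|k IH] a phi /=; first by move=> + x.
by move=> ph h; apply: eq_phase (IH _ _ (ph h)) => x; rewrite addnAC.
Qed.

Lemma phase1 k : phase k 1 (fun=> 1).
Proof. by elim: k => //= k IH h; rewrite expr1n; apply: eq_phase IH => x; rewrite divr1. Qed.

Lemma phaseM k a b phi psi : phase k a phi -> phase k b psi ->
  phase k (a * b) (fun x => phi x * psi x).
Proof.
elim: k a b phi psi => [|k IH] a b phi psi /=; first by move=> e f x; rewrite e f.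
move=> ph ps h; rewrite exprMn.
by apply: eq_phase (IH _ _ _ _ (ph h) (ps h)) => x; rewrite invfM mulrACA.
Qed.

Lemma phase_prod (I : Type) (s : seq I) k (b : I -> R[i]) (psi : I -> nat -> R[i]) :
  (forall i, phase k (b i) (psi i)) ->
  phase k (\prod_(i <- s) b i) (fun x => \prod_(i <- s) psi i x).
Proof.
move=> ph; elim: s => [|i s IH].
  by rewrite big_nil; apply: eq_phase (phase1 k) => x; rewrite big_nil.
by rewrite big_cons; apply: eq_phase (phaseM (ph i) IH) => x; rewrite big_cons.
Qed.

Lemma phaseS k a phi : a != 0 -> phase k a phi -> phase k.+1 1 phi.
Proof.
elim: k a phi => [|k IH] a phi a0 /=.
  by move=> e h x; rewrite !e expr1n divff.
move=> ph h; rewrite expr1n; apply: (IH (a ^+ h)); first by rewrite expf_neq0.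
exact: ph.
Qed.

Lemma phase_weaken k n a phi : a != 0 -> (k < n)%N -> phase k a phi -> phase n 1 phi.
Proof.
move=> a0; elim: n => // n IH; rewrite ltnS leq_eqVlt => /orP[/eqP <-|lt] ph.
  exact: phaseS ph.
by apply: phaseS (IH lt ph); rewrite oner_eq0.
Qed.

(** Differencing expands by the binomial theorem into monomials of lower degree. Only the top one
    contributes to the leading coefficient, and its factor [k.+1 * h] builds up the factorial; the
    others count as phases with trivial coefficient by [phase_weaken]. *)
Lemma phase_monomial k b : b != 0 -> phase k (b ^+ k`!) (fun x => b ^+ (x ^ k)).
Proof.
elim/ltn_ind: k b => -[|k] IH b b0 //= h.
pose psi (i : 'I_k.+1) x := (b ^+ ('C(k.+1, i) * h ^ (k.+1 - i))) ^+ (x ^ i).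
have bn n : b ^+ n != 0 by rewrite expf_neq0.
have e : (fun x => \prod_(i < k.+1) psi i x) =1
         (fun x => b ^+ ((x + h) ^ k.+1) / b ^+ (x ^ k.+1)).
  move=> x; rewrite addnC expnDn [in RHS]big_ord_recr /= subnn expn0 binn !mul1n exprD mulfK //.
  rewrite -prodrXr; apply: eq_bigr => i _; rewrite /psi -exprM.
  by rewrite mulnA.
apply: eq_phase e _.
have -> : b ^+ k.+1`! ^+ h =
    \prod_(i < k.+1) (if i == ord_max then b ^+ (k.+1 * h) ^+ k`! else 1).
  rewrite -big_mkcond big_pred1_eq -!exprM factS; congr (b ^+ _); lia.
apply: phase_prod => i; rewrite /psi.
have := IH i (ltn_ord i) _ (bn ('C(k.+1, i) * h ^ (k.+1 - i))%N).
case: eqP => [-> /=|ne ph]; first by rewrite binSn subSnn expn1.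
apply: phase_weaken ph; first by rewrite expf_neq0.
by rewrite ltn_neqAle -ltnS ltn_ord andbT; apply: contra_notN ne => /eqP e'; apply: val_inj.
Qed.

Lemma conj_sum_unit (X : nat) phi : (forall x, cnorm (phi x) = 1) ->
  ((\sum_(x < X) phi x)^*)%C = \sum_(x < X) (phi x)^-1.
Proof. by move=> phi1; rewrite rmorph_sum; apply: eq_bigr => x _ /=; rewrite conj_unit. Qed.

Lemma sum_below_diagonal (X : nat) (F : nat -> nat -> R[i]) :
  \sum_(x < X) \sum_(y < x) F x y =
  \sum_(h < X) \sum_(x < X - h.+1) F (x + h.+1)%N x.
Proof.
elim: X => [|X IH]; first by rewrite !big_ord0.
rewrite big_ord_recr IH [RHS]big_ord_recr /= subnn big_ord0 addr0.
rewrite [X in _ + X](reindex_inj rev_ord_inj) -big_split /=.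
apply: eq_bigr => h _; rewrite subSn // big_ord_recr /=; congr (_ + F _ _).
by rewrite subnK.
Qed.

(** Expanding the square, the diagonal gives [X] and the two triangles are complex conjugates, each
    grouped by the difference of the indices. All shifts are kept, without truncation, since a
    polynomial loss is affordable. *)
Lemma van_der_corput (X : nat) phi : (forall x, cnorm (phi x) = 1) ->
  cnorm (\sum_(x < X) phi x) ^+ 2 <=
  X%:R + 2 * \sum_(h < X) cnorm (\sum_(x < X - h.+1) phi (x + h.+1)%N / phi x).
Proof.
move=> phi1; pose F x y := phi x / phi y.
pose L := \sum_(x < X) \sum_(y < x) F x y.
have -> : cnorm (\sum_(x < X) phi x) ^+ 2 = cnorm (X%:R + (L + (L^*)%C)).
  rewrite expr2 -[in X in _ * X]cnorm_conj -cnormM conj_sum_unit //; congr cnorm.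
  have -> : (L^*)%C = \sum_(x < X) \sum_(y < x) F y x.
    rewrite rmorph_sum; apply: eq_bigr => x _; rewrite rmorph_sum.
    apply: eq_bigr => y _; rewrite /F /= conj_unit ?invfM ?invrK 1?mulrC //.
    by rewrite cnorm_unitM // cnorm_unitV.
  rewrite /L; elim: (X) => [|n IH]; first by rewrite !big_ord0 mul0r !addr0.
  rewrite !big_ord_recr /= mulrDl !mulrDr IH -natr1 divff ?unit_neq0 //.
  by rewrite mulr_suml mulr_sumr /F; ring.
apply: (le_trans (cnormD _ _)); rewrite cnorm_nat lerD2l.
apply: (le_trans (cnormD _ _)); rewrite cnorm_conj -mulr2n -[_ *+ 2]mulr_natl ler_pM2l //.
by rewrite /L sum_below_diagonal cnorm_sum.
Qed.

Lemma weyl1 (X T : nat) a phi : (forall x, cnorm (phi x) = 1) -> cnorm a = 1 ->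
  phase 1 a phi -> X%:R <= T%:R * cnorm (\sum_(x < X) phi x) ->
  udist a * X%:R <= 2 * T%:R.
Proof.
move=> phi1 a1 ph le.
have e x : phi x = phi 0%N * a ^+ x.
  by rewrite -(ph x 0%N) add0n mulrC divfK // unit_neq0.
have := udist_le2 (cnorm_unitX X a1).
rewrite /udist subrX1 cnormM -/(udist a).
have -> : cnorm (\sum_(i < X) a ^+ i) = cnorm (\sum_(x < X) phi x).
  by under [in RHS]eq_bigr do rewrite e; rewrite -mulr_sumr cnormM phi1 mul1r.
move=> le2; apply: le_trans (ler_wpM2l (udist_ge0 a) le) _.
by rewrite mulrCA mulrC ler_wpM2r.
Qed.

(** Terms below [X / (8 * T ^ 2)] account for at most half of the assumed lower bound for the sum;
    the others are at most [X] each, so there must be at least [X / (8 * T ^ 2)] of them. *)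
Lemma many_large_terms (X T : nat) (S : nat -> R) : (0 < T)%N ->
  (forall h, (h < X)%N -> S h <= X%:R) ->
  X%:R ^+ 2 <= 4 * T%:R ^+ 2 * \sum_(h < X) S h ->
  (X <= 8 * T ^ 2 * size [seq h <- iota 0 X | (X%:R <= (8 * T ^ 2)%N%:R * S h)%R])%N.
Proof.
move=> T0 SX big; set g := size _.
have T1 : 1 <= T%:R ^+ 2 :> R by rewrite -natrX ler1n expn_gt0 T0.
have [->|X0] := posnP X; first by [].
suff : X%:R <= (8 * T ^ 2)%N%:R * g%:R :> R by rewrite -natrM ler_nat.
pose good h : R := (X%:R <= (8 * T ^ 2)%N%:R * S h)%R%:R.
have gE : g%:R = \sum_(h < X) good h.
  rewrite -(big_mkord xpredT good) /index_iota subn0 /g size_filter -sum1_count.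
  by rewrite natr_sum big_mkcond; apply: eq_bigr => i _; rewrite /good; case: ifP.
have le : (8 * T ^ 2)%N%:R * \sum_(h < X) S h <=
    (8 * T ^ 2)%N%:R * X%:R * g%:R + X%:R * X%:R.
  have -> : X%:R * X%:R = \sum_(h < X) (X%:R : R).
    by rewrite sumr_const card_ord mulr_natr.
  rewrite gE !mulr_sumr -big_split /=; apply: ler_sum => h _.
  rewrite /good; case: (leP X%:R ((8 * T ^ 2)%N%:R * S h)) => [_|lt].
    by rewrite mulr1n mulr1 ler_wpDr // ler_wpM2l ?SX.
  by rewrite mulr0n mulr0 add0r ltW.
rewrite natrM natrX in le *.
have : 0 < X%:R :> R by rewrite ltr0n.
nra.
Qed.

Definition weyl_bound k (f : nat -> nat) := forall (T X : nat) a phi,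
  (0 < T)%N -> (forall x, cnorm (phi x) = 1) -> cnorm a = 1 -> phase k a phi ->
  X%:R <= T%:R * cnorm (\sum_(x < X) phi x) ->
  exists q, (0 < q <= f T)%N /\ udist (a ^+ q) * X%:R ^+ k <= (f T)%:R.

(* The last two summands cover the ranges of [X] in which [q = 1] works because
   [udist] is at most 2; the others come from the pigeonhole over the [K]
   possible return times of the differenced sums. *)
Definition weyl_next k (f : nat -> nat) (T : nat) : nat :=
  let T1 := (8 * T ^ 2)%N in let K := f T1 in
  let s := (T1 * K)%N in let K2 := (K * T1 ^ k)%N in
  (1 + 2 * s * K + 128 * s ^ 2 * K2 + 2 * (64 * s * K2) ^ k.+1 + 2 * T1 ^ k.+1)%N.

Lemma weyl_bound_trivial k (X Y B : nat) a : cnorm a = 1 -> (X <= Y)%N ->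
  (2 * Y ^ k <= B)%N -> (0 < B)%N ->
  exists q, (0 < q <= B)%N /\ udist (a ^+ q) * X%:R ^+ k <= B%:R.
Proof.
move=> a1 XY YB B0; exists 1%N; split=> //; rewrite expr1.
apply: le_trans (_ : 2 * Y%:R ^+ k <= _); last by rewrite -natrX -natrM ler_nat.
by rewrite ler_pM ?udist_ge0 ?udist_le2 ?exprn_ge0 // lerXn2r ?nnegrE // ler_nat.
Qed.

(** Many differenced phases have large sums. Their leading coefficients are powers [a ^+ h], so
    induction brings some [a ^+ (h * q)] close to 1. Pigeonhole over [q <= K] fixes one [q] for many
    [h]; these are dense return times of [a ^+ q], and [vinogradov] gains the missing factor [X]. *)
Lemma weyl_step k f : (0 < k)%N -> weyl_bound k f -> weyl_bound k.+1 (weyl_next k f).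
Proof.
move=> k0 IH T X a phi T0 phi1 a1 ph big; rewrite /weyl_next.
set T1 := (8 * T ^ 2)%N; set K := f T1; set s := (T1 * K)%N.
set K2 := (K * T1 ^ k)%N; set B := (_ + _ + _ + _ + _)%N.
have B0 : (0 < B)%N by rewrite /B; lia.
have T10 : (0 < T1)%N by rewrite muln_gt0 expn_gt0 T0.
have [small|large] := leqP X T1.
  by apply: weyl_bound_trivial small _ B0 => //; rewrite /B leq_addl.
pose S h := cnorm (\sum_(x < X - h.+1) phi (x + h.+1)%N / phi x).
have SX h : S h <= (X - h.+1)%:R.
  rewrite /S (le_trans (cnorm_sum _ _ _)) // [X in _ <= X%:R](_ : _ = \sum_(x < X - h.+1) 1)%N.
    rewrite natr_sum; apply: ler_sum => x _.
    by rewrite cnormM cnormV !phi1 invr1 mulr1.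
  by rewrite sum1_card card_ord.
have vdc : X%:R ^+ 2 <= 4 * T%:R ^+ 2 * \sum_(h < X) S h.
  have := van_der_corput X phi1; rewrite -/S.
  set sumS := \sum_(h < X) _; set N := cnorm _ in big *.
  have T1R : 1 <= T%:R :> R by rewrite ler1n.
  have : 8 * T%:R ^+ 2 <= X%:R :> R by rewrite -natrX -natrM ler_nat ltnW.
  have : X%:R ^+ 2 <= T%:R ^+ 2 * N ^+ 2 by rewrite -exprMn lerXn2r ?nnegrE // mulr_ge0 ?cnorm_ge0.
  have : 0 <= X%:R :> R by [].
  nra.
have S_le h : (h < X)%N -> S h <= X%:R.
  by move=> _; rewrite (le_trans (SX h)) // ler_nat leq_subr.
have := many_large_terms T0 S_le vdc; rewrite -/T1.
set G := filter _ _ => dense.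
pose good h q := udist (a ^+ (h.+1 * q)) * X%:R ^+ k <= K2%:R.
have GP h : h \in G -> (h < X)%N /\ exists q, (0 < q <= K)%N /\ good h q.
  rewrite mem_filter mem_iota add0n => /and3P[Sh _ hX]; split=> //.
  (* A sum that is large compared with [X] cannot be short. This allows replacing the length
     [X - h.+1] in the inductive bound by [X] at the cost of [T1 ^ k]. *)
  have Y_large : (X <= T1 * (X - h.+1))%N.
    by rewrite -(ler_nat R) natrM (le_trans Sh) // ler_wpM2l.
  have le : (X - h.+1)%:R <= T1%:R * S h.
    by rewrite (le_trans _ Sh) // ler_nat leq_subr.
  have unit x : cnorm (phi (x + h.+1)%N / phi x) = 1 by rewrite cnormM cnormV !phi1 invr1 mulr1.
  have [q [q0 qK]] := IH _ _ _ _ T10 unit (cnorm_unitX h.+1 a1) (ph h.+1) le.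
  exists q; split=> //; rewrite /good exprM.
  have : X%:R ^+ k <= T1%:R ^+ k * (X - h.+1)%:R ^+ k :> R.
    by rewrite -exprMn lerXn2r ?nnegrE ?mulr_ge0 // -natrM ler_nat.
  move=> /(ler_wpM2l (udist_ge0 (a ^+ h.+1 ^+ q))) /le_trans; apply.
  by rewrite mulrCA mulrC /K2 natrM natrX ler_wpM2r // exprn_ge0.
pose c h := find (fun q => good h q.+1) (iota 0 K).
have cP h : h \in G -> (c h < K)%N /\ good h (c h).+1.
  case/GP=> _ [q [/andP[q0 qK] gq]].
  have hs : has (fun q => good h q.+1) (iota 0 K).
    by apply/hasP; exists q.-1; rewrite ?mem_iota ?prednK //; lia.
  have cK : (c h < K)%N by rewrite -[K in X in (_ < X)%N](size_iota 0) -has_find.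
  split=> //; have := nth_find 0%N hs; rewrite -/(c h) nth_iota //.
have G0 : (0 < size G)%N by lia.
have K0 : (0 < K)%N.
  by case: (G) G0 cP => // h G' _ /(_ h (mem_head _ _))[+ _]; lia.
have cK : {in G, forall h, c h < K}%N by move=> h /cP[].
have Kn : (K * ((size G).-1 %/ K) < size G)%N.
  by have := leq_divM (size G).-1 K; lia.
have [q [qK many]] := pigeonhole cK Kn.
set G' := filter _ _ in many.
have G'P h : h \in G' -> h \in G /\ good h q.+1.
  by rewrite mem_filter => /andP[/eqP ch hG]; have [_] := cP h hG; rewrite ch.
pose e : R := K2%:R / X%:R ^+ k.
have X0 : 0 < X%:R :> R by rewrite ltr0n; lia.
have Xk0 : 0 < X%:R ^+ k :> R by rewrite exprn_gt0.
have a1' : cnorm (a ^+ q.+1) = 1 by rewrite cnorm_unitX.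
have uG : uniq [seq h.+1 | h <- G'].
  by rewrite (map_inj_uniq succn_inj) !filter_uniq // iota_uniq.
have GX : {in [seq h.+1 | h <- G'], forall h, 0 < h <= X}%N.
  by move=> _ /mapP[h /G'P[/GP[hX _] _] ->].
have dense' : (X <= s * size [seq h.+1 | h <- G'])%N.
  rewrite size_map /s -mulnA (leq_trans dense) // leq_mul2l; apply/orP; right.
  apply: leq_trans (_ : K * ((size G).-1 %/ K).+1 <= _)%N; last by rewrite leq_mul2l many orbT.
  by rewrite -[size G]prednK // mulnC ltn_ceil.
have Ge : {in [seq h.+1 | h <- G'], forall h, udist (a ^+ q.+1 ^+ h) <= e}.
  move=> _ /mapP[h /G'P[_ gh] ->].
  by rewrite /e ler_pdivlMr // -exprM mulnC.
have [small|large'] := ltP (64 * s%:R * e) 1.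
  have [q' [/andP[q'0 q's] q'P]] :=
    vinogradov a1' uG GX (leq_ltn_trans (leq0n _) large) dense' Ge small.
  exists (q.+1 * q')%N; split.
    rewrite muln_gt0 q'0 /= (leq_trans (leq_mul qK q's)) // /B mulnC; lia.
  rewrite exprM [X%:R ^+ _]exprS mulrA.
  apply: le_trans (ler_wpM2r (ltW Xk0) q'P) _.
  rewrite /e -!mulrA mulVf ?gt_eqF // mulr1 -!natrM ler_nat /B.
  rewrite [(s * (s * _))%N]mulnA mulnn mulnA; lia.
(* Here [e] is not small, which bounds [X] in terms of [T], so that [q = 1] works. *)
have XY : (X <= 64 * s * K2)%N.
  have X1 : (1 <= X)%N by apply: leq_trans large.
  apply: leq_trans (_ : X ^ k <= _)%N; first by rewrite -{1}[X]expn1 leq_pexp2l.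
  move: large'; rewrite /e mulrA ler_pdivlMr // mul1r.
  by rewrite -natrX -!natrM ler_nat.
apply: weyl_bound_trivial XY _ B0 => //.
by rewrite /B addnAC leq_addl.
Qed.

Lemma weyl k : (0 < k)%N -> exists f, poly_bounded f /\ weyl_bound k f.
Proof.
case: k => // k _; elim: k => [|k [f [pf IH]]].
  exists (fun T => 2 * T)%N; split.
    exact: poly_boundedM (poly_bounded_const 2) poly_bounded_id.
  move=> T X a phi T0 phi1 a1 ph le; exists 1%N; split; first by lia.
  by rewrite !expr1 natrM (weyl1 phi1).
exists (weyl_next k.+1 f); split; last exact: weyl_step.
pose T1 T := (8 * T ^ 2)%N.
have pT1 : poly_bounded T1.
  by apply: poly_boundedM (poly_bounded_const 8) (poly_boundedX 2 poly_bounded_id).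
have pK : poly_bounded (fun T => f (T1 T)).
  apply: poly_bounded_comp pf pT1 => T T0.
  by rewrite muln_gt0 expn_gt0 T0.
have ps := poly_boundedM pT1 pK.
have pK2 := poly_boundedM pK (poly_boundedX k.+1 pT1).
have pc := poly_bounded_const.
rewrite /weyl_next.
apply: poly_boundedD; last exact: poly_boundedM (pc 2) (poly_boundedX _ pT1).
apply: poly_boundedD; last first.
  exact: poly_boundedM (pc 2) (poly_boundedX _ (poly_boundedM (poly_boundedM (pc 64) ps) pK2)).
apply: poly_boundedD; last first.
  exact: poly_boundedM (poly_boundedM (pc 128) (poly_boundedX 2 ps)) pK2.
apply: poly_boundedD; first exact: pc.
exact: poly_boundedM (poly_boundedM (pc 2) ps) pK.
Qed.
End Weyl.

(** * Integral linear dependence *)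

Lemma det_bound m (A : 'M[int]_m) (H : nat) :
  (forall i j, `|A i j| <= H%:Z) -> `|\det A : int| <= ((m)`! * H ^ m)%N%:Z.
Proof.
move=> AH; apply: le_trans (ler_norm_sum _ _ _) _.
apply: le_trans (_ : \sum_(s : 'S_m) (H ^ m)%N%:Z <= _).
  apply: ler_sum => s _; rewrite normrM normrX normrN1 expr1n mul1r normr_prod.
  rewrite -natz natrX -[X in _ ^+ X]card_ord -prodr_const.
  by apply: ler_prod => i _; rewrite normr_ge0 natz AH.
by rewrite sumr_const card_Sn -mulr_natl natz PoszM.
Qed.

Lemma mulmx_adj_bound m (v : 'rV[int]_m) (A : 'M[int]_m) (H : nat) i :
  (forall j, `|v 0 j| <= H%:Z) -> (forall i j, `|A i j| <= H%:Z) ->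
  `|(v *m \adj A) 0 i| <= ((m)`! * H ^ m)%N%:Z.
Proof.
case: m v A i => [|m] v A i vH AH; first by case: i.
rewrite mxE; apply: le_trans (ler_norm_sum _ _ _) _.
apply: le_trans (_ : \sum_(j < m.+1) (H * ((m)`! * H ^ m))%N%:Z <= _).
  apply: ler_sum => j _; rewrite normrM PoszM ler_pM ?vH // mxE.
  rewrite normrM normrX normrN1 expr1n mul1r.
  by apply: det_bound => k l; rewrite !mxE.
rewrite sumr_const card_ord -mulr_natl natz -PoszM lez_nat factS expnS; lia.
Qed.

(** [L] is the absolute value of a nonzero maximal minor of [B]. Cramer's rule on its columns gives
    integral coefficients, and the other columns follow because [a] lies in the row span. [L] is
    chosen before [a], so that one multiplier serves the whole span. *)
Lemma cramer_bound m r (B : 'M[int]_(m, r)) (H : nat) :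
  (forall i j, `|B i j| <= H%:Z) ->
  row_free (map_mx intr B : 'M[rat]_(m, r)) ->
  exists L : nat, (0 < L <= (m)`! * H ^ m)%N /\
    forall a : 'rV[int]_r, (forall j, `|a 0 j| <= H%:Z) ->
      ((map_mx intr a : 'rV[rat]_r) <= (map_mx intr B : 'M[rat]_(m, r)))%MS ->
      exists c : 'rV[int]_m, (forall i, `|c 0 i| <= ((m)`! * H ^ m)%N%:Z) /\
        L%:Z *: a = c *m B.
Proof.
move=> BH; rewrite -row_leq_rank => fB.
have full : row_full (map_mx intr B : 'M[rat]_(m, r))^T.
  by rewrite -col_leq_rank mxrank_tr.
pose f := fullrankfun full.
pose Bf := colsub f B.
have BfH i j : `|Bf i j| <= H%:Z by rewrite mxE BH.
have d0 : \det Bf != 0.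
  have := fullrowsub_unit full; rewrite unitmxE unitfE.
  rewrite -det_tr (_ : _^T = map_mx intr Bf); last by apply/matrixP => i j; rewrite !mxE.
  by rewrite det_map_mx intr_eq0.
pose L := `|\det Bf|%N; exists L; split.
  by rewrite absz_gt0 d0 /= -lez_nat abszE det_bound.
move=> a aH /submxP[u au].
pose c := (sgz (\det Bf)) *: (colsub f a *m \adj Bf).
have cu : map_mx intr c = (`|\det Bf|%N%:Z)%:~R *: u.
  rewrite map_mxZ map_mxM map_mx_adj.
  have -> : map_mx intr (colsub f a) = u *m map_mx intr Bf.
    apply/matrixP => i j; rewrite !mxE ord1.
    move/matrixP/(_ 0 (f j)): au; rewrite !mxE => ->.
    by apply: eq_bigr => k _; rewrite !mxE.
  rewrite -mulmxA mul_mx_adj mul_mx_scalar scalerA det_map_mx -intrM.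
  by rewrite abszE -[in LHS]normrEsg.
exists c; split.
  move=> i; rewrite mxE normrM normr_sg d0 mul1r.
  by apply: mulmx_adj_bound => // j; rewrite mxE aH.
have /matrixP e : map_mx intr (L%:Z *: a) = map_mx intr (c *m B) :> 'M[rat]_(_, _).
  by rewrite map_mxZ map_mxM cu -scalemxAl -au.
by apply/matrixP => i j; have := e i j; rewrite !mxE => /intr_inj.
Qed.

Section CramerSeq.
Variable r : nat.
Implicit Types (a b : 'rV[int]_r) (X : seq 'rV[int]_r).

Definition ratrow a : 'rV[rat]_r := map_mx intr a.

Definition zfree X := free (map ratrow X).

Definition qspan X a := ratrow a \in <<map ratrow X>>%VS.

Lemma size_zfree X : zfree X -> (size X <= r)%N.
Proof.
rewrite /zfree /free size_map => /eqP <-.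
by rewrite (leq_trans (dimvS (subvf _))) // dimvf /dim /= mul1n.
Qed.

Lemma zfree_cons a X : zfree (a :: X) = ~~ qspan X a && zfree X.
Proof. by rewrite /zfree /= free_cons. Qed.

Lemma cramer_seq X (H : nat) : (0 < H)%N ->
  {in X, forall b j, `|b 0 j| <= H%:Z} -> zfree X ->
  exists L : nat, (0 < L <= (r)`! * H ^ r)%N /\
    forall a, (forall j, `|a 0 j| <= H%:Z) -> qspan X a ->
      exists c : 'I_(size X) -> int, (forall i, `|c i| <= ((r)`! * H ^ r)%N%:Z) /\
        L%:Z *: a = \sum_i c i *: X`_i.
Proof.
move=> H0 XH fX; have Xr := size_zfree fX.
pose B := \matrix_(i < size X) X`_i.
have le_bound : ((size X)`! * H ^ size X <= (r)`! * H ^ r)%N.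
  by rewrite leq_mul ?leq_pexp2l // leq_fact.
have nth_rat (i : 'I_(size X)) : (map ratrow X)`_i = row i (map_mx intr B).
  by rewrite (nth_map 0) // /ratrow -map_row rowK.
have BH i j : `|B i j| <= H%:Z by rewrite mxE XH // mem_nth.
have fB : row_free (map_mx intr B : 'M[rat]_(_, r)).
  apply: inj_row_free => v; rewrite mulmx_sum_row => v0.
  apply/rowP => i; rewrite mxE.
  have /freeP fr : free (in_tuple (map ratrow X)) := fX.
  have i' : (i < size (map ratrow X))%N by rewrite size_map.
  have := fr (fun j => if insub (val j) is Some j' then v 0 j' else 0) _ (Ordinal i').
  rewrite /= valK; apply.
  rewrite -{}[RHS]v0 /= -(big_mkord xpredT (fun j => (if insub j is Some j' then v 0 j' else 0) *: (map ratrow X)`_j)) size_map big_mkord.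
  by apply: eq_bigr => j _; rewrite valK nth_rat.
have [L [/andP[L0 LB] Lspan]] := cramer_bound BH fB.
exists L; split; first by rewrite L0 (leq_trans LB).
move=> a aH ain; have [|c [cH cE]] := Lspan a aH.
  have := coord_span (ain : _ \in <<in_tuple (map ratrow X)>>%VS) => e.
  rewrite -/(ratrow a) e /= summx_sub // => i _; apply: scalemx_sub.
  have i' : (i < size X)%N by rewrite -[size X](size_map ratrow).
  by rewrite (nth_rat (Ordinal i')) row_sub.
exists (fun i => c 0 i); split=> [i|]; first by rewrite (le_trans (cH i)) ?lez_nat.
by rewrite cE mulmx_sum_row; apply: eq_bigr => i _; rewrite rowK.
Qed.
End CramerSeq.

(** * Removing frequencies *)

Section Step.
Variables (R : rcfType) (k r : nat) (z : 'I_r -> R[i]).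
Hypotheses (k_gt0 : (0 < k)%N) (z1 : forall s, cnorm (z s) = 1).
Implicit Types (a b : 'rV[int]_r).

Definition character a : R[i] := \prod_s z s ^ a 0 s.

Lemma character_unit a : cnorm (character a) = 1.
Proof. by rewrite cnorm_prod big1 // => s _; rewrite cnorm_unitz. Qed.

Lemma characterD a b : character (a + b) = character a * character b.
Proof.
rewrite -big_split; apply: eq_bigr => s _.
by rewrite mxE expfzDr // unit_neq0.
Qed.

Lemma character0 : character 0 = 1.
Proof. by rewrite /character big1 // => s _; rewrite mxE expr0z. Qed.

Lemma characterZ (c : int) a : character (c *: a) = character a ^ c.
Proof.
rewrite /character (big_morph (fun x : R[i] => x ^ c) (fun x y => expfzMl x y c) (exp1rz _ c)).
by apply: eq_bigr => s _; rewrite mxE mulrC exprz_exp.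
Qed.

Lemma character_sum (n : nat) (c : 'I_n -> int) (b : 'I_n -> 'rV[int]_r) :
  character (\sum_i c i *: b i) = \prod_i character (b i) ^ c i.
Proof.
rewrite (big_morph character characterD character0).
by apply: eq_bigr => i _; rewrite characterZ.
Qed.

Definition poly_phase (a : 'I_k -> 'rV[int]_r) (d : nat) : R[i] :=
  \prod_(j < k) character (a j) ^+ (d ^ j.+1).

Variables (H T : nat) (f : nat -> nat).
Hypotheses (H_gt0 : (0 < H)%N) (T_gt0 : (0 < T)%N)
  (f_weyl : forall j, (j < k)%N -> weyl_bound R j.+1 f).

(** [Delta] bounds the determinants and coefficients of Cramer's rule. In [G], the factor
    [Delta ^ k] pays for one determinant per degree, [r.+1 * Delta] for a sum of at most [r]
    coefficients, and [2 * k * T] leaves a total error of [1 / (2 * T)] over [k] monomials. [K] is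
    the growth in one step: Weyl's multiplier, the factorial in its leading coefficient, and the
    passage between the scales [X] and [D]. *)
Let Delta := ((r)`! * H ^ r)%N.
Let G := (Delta ^ k * (r.+1 * Delta) * (2 * k * T))%N.
Let K := (f (2 * T) * k`! * (2 * G))%N.

Definition height_le a := forall s, `|a 0 s| <= H%:Z.

(* The vectors of [B j] are frequencies that the multiples of [q] have made
   almost trivial on the monomial of degree [j.+1], at scale [D]. Measuring the
   size by [(Kt / D) ^ j.+1] makes each step cost a factor, not a power. *)
Definition state (D t Kt : nat) := exists (B : 'I_k -> seq 'rV[int]_r) (q : nat),
  [/\ (\sum_j size (B j) = t)%N, (0 < q <= Kt)%N,
      forall j, zfree (B j),
      forall j b, b \in B j -> height_le b &
      forall j b, b \in B j ->
        udist (character b ^+ (q ^ j.+1)) * D%:R ^+ j.+1 <= Kt%:R ^+ j.+1].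

(** The dichotomy that the positive kernel requires: in the first case every term of the sum has
    nonnegative real part, in the second the sum is small enough to be absorbed by the diagonal. The
    shift [x.+1] keeps the argument positive. *)
Definition resolved (D : nat) := exists Q X : nat,
  [/\ (0 < Q)%N, (0 < X)%N, (Q * X <= D)%N &
   forall a : 'I_k -> 'rV[int]_r, (forall j, height_le (a j)) ->
     (forall x, (x < X)%N -> udist (poly_phase a (Q * x.+1)) <= 1) \/
     T%:R * cnorm (\sum_(x < X) poly_phase a (Q * x.+1)) <= X%:R].

Lemma state0 D : state D 0 1.
Proof.
exists (fun=> [::]), 1%N; split=> //; first by rewrite big1.
by move=> j; rewrite /zfree /= nil_free.
Qed.

Lemma state_size D t Kt : state D t Kt -> (t <= k * r)%N.
Proof.
case=> B [q [<- _ fB _ _]]; rewrite -[k in X in (_ <= X)%N]card_ord -sum_nat_const.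
by apply: leq_sum => j _; apply: size_zfree.
Qed.

Lemma Delta_gt0 : (0 < Delta)%N.
Proof. by rewrite muln_gt0 fact_gt0 expn_gt0 H_gt0. Qed.

Lemma G_gt0 : (0 < G)%N.
Proof. by rewrite !muln_gt0 !expn_gt0 Delta_gt0 fact_gt0 H_gt0 k_gt0 T_gt0. Qed.

Section Near.
Variables (D Kt q : nat) (j : 'I_k) (X0 : seq 'rV[int]_r) (L0 L : nat).
Hypotheses (D_gt0 : (0 < D)%N) (Kt_gt0 : (0 < Kt)%N)
  (sX0 : (size X0 <= r)%N)
  (X0small : forall b, b \in X0 ->
        udist (character b ^+ (q ^ j.+1)) * D%:R ^+ j.+1 <= Kt%:R ^+ j.+1)
  (L0_gt0 : (0 < L0)%N) (L0L : (L0 %| L)%N) (L_gt0 : (0 < L)%N) (LD : (L <= Delta ^ k)%N).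

(* By Cramer's rule a power [L0] of the character of [a] is a product of small
   powers of the characters in [X0]; this is why [q] is multiplied by [L]. *)
Lemma spanned_small a (c : 'I_(size X0) -> int) (x : nat) :
  (forall i, `|c i| <= Delta%:Z) -> L0%:Z *: a = \sum_i c i *: X0`_i ->
  (x * (G * Kt) <= D)%N ->
  2 * k%:R * T%:R * udist (character a ^+ ((q * L * x) ^ j.+1)) <= 1.
Proof.
move=> cD ca xD; set n := j.+1.
(* [L0] divides [L], hence [L ^ n], so the power factors through [character a ^+ L0], to which the
   Cramer relation applies. *)
pose M := (L ^ n %/ L0)%N.
have LM : (L ^ n = L0 * M)%N.
  by rewrite mulnC divnK // (dvdn_trans L0L) // dvdn_exp.
have aL : character a ^+ L0 = \prod_(i < size X0) character X0`_i ^ c i.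
  by rewrite -character_sum -ca characterZ.
have le1 : udist (character a ^+ L0 ^+ (q ^ n)) * D%:R ^+ n <= (r * Delta)%N%:R * Kt%:R ^+ n.
  rewrite aL -prodrXl.
  have u (i : 'I_(size X0)) : cnorm ((character X0`_i ^ c i) ^+ (q ^ n)) = 1.
    by rewrite cnorm_unitX // cnorm_unitz // character_unit.
  apply: le_trans (ler_wpM2r _ (udist_prod _ (fun i _ => u i))) _; first by rewrite exprn_ge0.
  rewrite mulr_suml; apply: le_trans (_ : \sum_(i < size X0) Delta%:R * Kt%:R ^+ n <= _).
    apply: ler_sum => i _.
    have -> : (character X0`_i ^ c i) ^+ (q ^ n) = (character X0`_i ^+ (q ^ n)) ^ c i.
      by rewrite [LHS]exprnP [in RHS]exprnP !exprz_exp mulrC.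
    apply: le_trans (ler_wpM2r _ (udist_exprz _ _)) _.
    - by rewrite exprn_ge0.
    - by rewrite cnorm_unitX // character_unit.
    rewrite -mulrA ler_pM // ?mulr_ge0 ?udist_ge0 ?exprn_ge0 //.
      by rewrite ler_nat -lez_nat abszE cD.
    exact: X0small (mem_nth _ _).
  rewrite sumr_const card_ord -[X in X <= _]mulr_natl mulrA -natrM.
  by rewrite ler_wpM2r ?exprn_ge0 // ler_nat leq_mul2r sX0 orbT.
have -> : character a ^+ ((q * L * x) ^ n) = character a ^+ L0 ^+ (q ^ n) ^+ (M * x ^ n).
  by rewrite -!exprM !expnMn LM; congr (_ ^+ _); ring.
have Dn : 0 < D%:R ^+ n :> R by rewrite exprn_gt0 // ltr0n.
rewrite -(ler_pM2r Dn) mul1r.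
set v := udist _; set w := udist (character a ^+ L0 ^+ (q ^ n)) in le1 *.
have vw : v <= (M * x ^ n)%N%:R * w by rewrite /v udistX ?cnorm_unitX // character_unit.
apply: le_trans (_ : 2 * k%:R * T%:R * ((M * x ^ n)%N%:R * ((r * Delta)%N%:R * Kt%:R ^+ n)) <= _).
  rewrite -[X in X <= _]mulrA ler_wpM2l ?mulr_ge0 //.
  by apply: le_trans (ler_wpM2r (ltW Dn) vw) _; rewrite -mulrA ler_wpM2l.
rewrite -!natrX -!natrM ler_nat.
apply: leq_trans (_ : (x * (G * Kt)) ^ n <= _)%N; last by rewrite leq_exp2r.
have Mle : (M <= (Delta ^ k) ^ n)%N.
  by rewrite (leq_trans (leq_div _ _)) // leq_exp2r.
have big : (2 * k * T * (r * Delta) <= (r.+1 * Delta * (2 * k * T)) ^ n)%N.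
  have e0 : (0 < r.+1 * Delta * (2 * k * T))%N.
    by rewrite !muln_gt0 !expn_gt0 fact_gt0 H_gt0 k_gt0 T_gt0.
  rewrite (leq_trans _ (leq_pexp2l e0 (ltn0Sn j))) // expn1 mulnC.
  by rewrite leq_mul2r leq_mul2r leqnSn !orbT.
have -> : (2 * k * T * (M * x ^ n * (r * Delta * Kt ^ n)) =
    x ^ n * Kt ^ n * (M * (2 * k * T * (r * Delta))))%N by ring.
have -> : ((x * (G * Kt)) ^ n = x ^ n * Kt ^ n *
   ((Delta ^ k) ^ n * (r.+1 * Delta * (2 * k * T)) ^ n))%N.
  by rewrite -!expnMn /G; congr (_ ^ _)%N; ring.
by rewrite leq_mul2l leq_mul ?orbT.
Qed.
End Near.
(* If a combination of frequencies neither is almost trivial nor has a small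
   exponential sum, then its monomials above the last one outside the span can be
   dropped, and Weyl's inequality makes that one almost trivial. *)
Lemma state_step D t Kt : (G * Kt <= D)%N -> state D t Kt ->
  resolved D \/ state D t.+1 (K * Kt).
Proof.
move=> GD [B [q [sumB /andP[q0 qK] fB hB smallB]]].
have Kt0 := leq_trans q0 qK.
have D0 : (0 < D)%N by rewrite (leq_trans _ GD) // muln_gt0 G_gt0.
have GKt0 : (0 < G * Kt)%N by rewrite muln_gt0 G_gt0.
have /fin_all_exists[L0 L0P] j := cramer_seq H_gt0 (fun b bB => hB j b bB) (fB j).
pose L := (\prod_j L0 j)%N.
have L0L j : (L0 j %| L)%N by rewrite /L (bigD1 j) //= dvdn_mulr.
have L_gt0 : (0 < L)%N by apply: prodn_gt0 => j; have [/andP[]] := L0P j.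
have LD : (L <= Delta ^ k)%N.
  rewrite -[k in X in (_ <= X)%N]card_ord -prod_nat_const.
  by apply: leq_prod => j _; have [/andP[]] := L0P j.
pose Q := (q * L)%N; pose X := (D %/ (G * Kt))%N.
have X_gt0 : (0 < X)%N by rewrite divn_gt0.
have XD : (X * (G * Kt) <= D)%N by rewrite leq_divM.
have DX : (D <= 2 * (G * Kt) * X)%N by rewrite leq_double_divM // GKt0.
have Q_gt0 : (0 < Q)%N by rewrite muln_gt0 q0.
have QX : (Q * X <= D)%N.
  apply: leq_trans XD; rewrite mulnC leq_mul2l; apply/orP; right.
  rewrite /Q /G mulnC leq_mul // -mulnA (leq_trans LD) // leq_pmulr //.
  by rewrite !muln_gt0 !expn_gt0 fact_gt0 H_gt0 k_gt0 T_gt0.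
have kT0 : 0 < 2 * k%:R * T%:R :> R by rewrite !mulr_gt0 // ltr0n.
pose delta : R := (2 * k%:R * T%:R)^-1.
have near (a : 'I_k -> 'rV[int]_r) j x : (forall j, height_le (a j)) ->
    qspan (B j) (a j) -> (x < X)%N ->
    udist (character (a j) ^+ ((Q * x.+1) ^ j.+1)) <= delta.
  move=> ha aj xX; have [/andP[L00 _] /(_ _ (ha j) aj)[c [cD ca]]] := L0P j.
  rewrite /delta -[X in _ <= X]mul1r ler_pdivlMr // mulrC.
  apply: (@spanned_small D Kt q j (B j) (L0 j) L) => //.
  - exact: size_zfree.
  - exact: smallB.
  - by rewrite (leq_trans _ XD) // leq_mul2r xX orbT.
have unit_j (a : 'I_k -> 'rV[int]_r) (P : pred 'I_k) x :
    cnorm (\prod_(j | P j) character (a j) ^+ (x ^ j.+1)) = 1.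
  by rewrite cnorm_prod big1 // => j _; rewrite cnorm_unitX // character_unit.
have near_prod (a : 'I_k -> 'rV[int]_r) (P : pred 'I_k) x : (forall j, height_le (a j)) ->
    (forall j, P j -> qspan (B j) (a j)) -> (x < X)%N ->
    udist (\prod_(j | P j) character (a j) ^+ ((Q * x.+1) ^ j.+1)) <= (2 * T%:R)^-1.
  move=> ha aP xX; apply: le_trans (udist_prod _ _) _.
    by move=> j _; rewrite cnorm_unitX // character_unit.
  apply: le_trans (_ : \sum_(j < k) delta <= _).
    rewrite big_mkcond; apply: ler_sum => j _; case: ifP => [Pj|_].
      exact: near (aP _ Pj) xX.
    by rewrite invr_ge0 ltW.
  rewrite sumr_const card_ord -[X in X <= _]mulr_natl /delta.
  rewrite [X in X <= _](_ : _ = (2 * T%:R)^-1) //; field.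
  by rewrite !pnatr_eq0 -!lt0n T_gt0.
have T2 : (2 * T%:R)^-1 <= 1 :> R.
  rewrite invf_le1 ?mulr_gt0 ?ltr0n // -natrM ler1n; lia.
have [res|/existsNP[a /not_implyP[ha /not_orP[notnear /negP]]]] := EM
    (forall a : 'I_k -> 'rV[int]_r, (forall j, height_le (a j)) ->
     (forall x, (x < X)%N -> udist (poly_phase a (Q * x.+1)) <= 1) \/
     T%:R * cnorm (\sum_(x < X) poly_phase a (Q * x.+1)) <= X%:R).
  by left; exists Q, X.
rewrite -ltNge => large; right.
(* If all [a i] were in their spans, every monomial would be almost trivial, contradicting
   [notnear]. The largest degree outside its span is selected below. *)
have ex_far : exists j : nat, [exists i : 'I_k, (i == j :> nat) && ~~ qspan (B i) (a i)].
  have [/existsP[i far]|/existsPn no] := boolP [exists i, ~~ qspan (B i) (a i)].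
    by exists i; apply/existsP; exists i; rewrite eqxx.
  case: notnear => x xX; apply: le_trans T2.
  by apply: near_prod => // j _; have := no j; rewrite negbK.
have far_k j : [exists i : 'I_k, (i == j :> nat) && ~~ qspan (B i) (a i)] -> (j <= k)%N.
  by case/existsP=> i /andP[/eqP <- _]; rewrite ltnW.
have [j0' /existsP[j0 /andP[/eqP <-{j0'} far]] max_far] := ex_maxnP ex_far far_k.
have above (j : 'I_k) : (j0 < j)%N -> qspan (B j) (a j).
  apply: contraTT => farj; rewrite -leqNgt; apply: max_far.
  by apply/existsP; exists j; rewrite eqxx.
pose lo (x : nat) := \prod_(j < k | (j <= j0)%N) character (a j) ^+ ((Q * x.+1) ^ j.+1).
(* Each discarded product is within [1 / (2 * T)] of 1, so half of the lower bound survives; hence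
   the argument [2 * T] of [f]. *)
have lo_large : X%:R <= (2 * T)%N%:R * cnorm (\sum_(x < X) lo x).
  have diff : cnorm (\sum_(x < X) (poly_phase a (Q * x.+1) - lo x)) <= X%:R * (2 * T%:R)^-1.
    apply: le_trans (cnorm_sum _ _ _) _.
    rewrite -[X in X%:R * _]card_ord mulr_natl -sumr_const; apply: ler_sum => x _.
    rewrite -udist_div ?unit_j // /lo /poly_phase (bigID (fun j : 'I_k => (j <= j0)%N)) /=.
    rewrite mulrC mulKf ?unit_neq0 ?unit_j // near_prod // => j.
    by rewrite -ltnNge; apply: above.
  have := cnormD (\sum_(x < X) (poly_phase a (Q * x.+1) - lo x)) (\sum_(x < X) lo x).
  rewrite sumrB subrK natrM => tri.
  have T0 : 0 < T%:R :> R by rewrite ltr0n.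
  rewrite sumrB ler_pdivlMr ?mulr_gt0 // in diff; nra.
pose beta (j : 'I_k) := character (a j) ^+ (Q ^ j.+1).
have beta1 j : cnorm (beta j) = 1 by rewrite cnorm_unitX // character_unit.
pose al := beta j0 ^+ (j0.+1)`!.
have lo_phase : phase j0.+1 al lo.
  pose psi (j : 'I_k) x := if (j <= j0)%N then beta j ^+ (x ^ j.+1) else 1.
  have e : (fun x => \prod_(j < k) psi j (x + 1)%N) =1 lo.
    move=> x; rewrite /lo [RHS]big_mkcond; apply: eq_bigr => j _; rewrite /psi.
    by case: ifP => // _; rewrite /beta -exprM -expnMn addn1.
  apply: eq_phase e _.
  have -> : al = \prod_(j < k) (if j == j0 then al else 1) by rewrite -big_mkcond big_pred1_eq.
  apply: (phase_shift (phi := fun x => \prod_j psi j x)).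
  apply: phase_prod => j; rewrite /psi; case: eqP => [->|ne].
    by rewrite leqnn; apply: phase_monomial; rewrite unit_neq0.
  case: leqP => [le|_]; last exact: phase1.
  apply: phase_weaken (phase_monomial j.+1 (unit_neq0 (beta1 j))).
    by rewrite expf_neq0 // unit_neq0.
  by rewrite ltnS ltn_neqAle le andbT; apply: contra_notN ne => /eqP e'; apply: val_inj.
have T20 : (0 < 2 * T)%N by rewrite muln_gt0 T_gt0.
have lo1 x : cnorm (lo x) = 1 by apply: unit_j.
have [q' [/andP[q'0 q'W] q'P]] :=
  f_weyl (ltn_ord j0) T20 lo1 (cnorm_unitX _ (beta1 j0)) lo_phase lo_large.
set W := f (2 * T)%N in q'W q'P.
set F := (j0.+1)`! in al lo_phase q'P.
have Fk : (F <= k`!)%N by apply: leq_fact; apply: ltn_ord.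
have F0 : (0 < F)%N by apply: fact_gt0.
have LG : (L <= 2 * G)%N.
  rewrite (leq_trans LD) // /G mulnC -mulnA -mulnA leq_pmulr //.
  by rewrite !muln_gt0 !expn_gt0 fact_gt0 H_gt0 k_gt0 T_gt0.
exists (fun j => if j == j0 then a j :: B j else B j), (q' * F * Q)%N; split.
- rewrite -sumB (bigD1 j0) //= eqxx [in RHS](bigD1 j0) //= addSn; congr (_ + _).+1.
  by apply: eq_bigr => j /negPf ->.
- rewrite muln_gt0 Q_gt0 andbT muln_gt0 q'0 F0 /=.
  rewrite /K /Q -mulnA [(F * _)%N]mulnCA; apply: leq_trans (_ : W * k`! * (2 * G) * Kt <= _)%N => //.
  have -> : (q' * (q * (F * L)) = q' * F * L * q)%N by ring.
  by rewrite leq_mul // leq_mul // leq_mul.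
- move=> j; case: eqP => [->|_]; last exact: fB.
  by rewrite zfree_cons far fB.
- move=> j b; case: eqP => [->|_]; last exact: hB.
  by rewrite in_cons => /orP[/eqP -> //|]; apply: hB.
move=> j b bB'; set n := j.+1.
(* Enlarging [q] by the factor [q' * F * L <= K] enlarges the error of an earlier vector by at most
   [K ^ n]. *)
have old : b \in B j -> udist (character b ^+ ((q' * F * Q) ^ n)) * D%:R ^+ n <= (K * Kt)%:R ^+ n.
  move=> bB; have b1 : cnorm (character b ^+ (q ^ n)) = 1 by rewrite cnorm_unitX // character_unit.
  have -> : ((q' * F * Q) ^ n = q ^ n * (q' * F * L) ^ n)%N by rewrite -expnMn; congr (_ ^ _)%N; rewrite /Q; ring.
  rewrite exprM; apply: le_trans (ler_wpM2r _ (udistX _ b1)) _; first by rewrite exprn_ge0.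
  rewrite -mulrA; apply: le_trans (ler_wpM2l _ (smallB j b bB)) _ => //.
  rewrite -natrX -natrM -natrX ler_nat -expnMn leq_exp2r //.
  by rewrite leq_mul2r; apply/orP; right; rewrite leq_mul // leq_mul.
move: bB'; case: eqP => [jj0|_ //]; rewrite in_cons => /orP[/eqP -> {b old}|//].
(* Weyl's inequality controls the power [al ^+ q'], which uses up one [q'] and one [F]; the
   remaining [(q' * F) ^ j] merely multiplies the error. *)
have -> : character (a j) ^+ ((q' * F * Q) ^ n) = al ^+ q' ^+ ((q' * F) ^ j).
  rewrite /al /beta -jj0 -!exprM; congr (_ ^+ _).
  by rewrite /n expnMn [((q' * F) ^ j.+1)%N]expnS; ring.
have al1 : cnorm (al ^+ q') = 1 by apply: cnorm_unitX; apply: cnorm_unitX.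
have Dn : D%:R ^+ n <= (2 * (G * Kt))%N%:R ^+ n * X%:R ^+ n :> R.
  by rewrite -exprMn lerXn2r ?nnegrE ?mulr_ge0 // -natrM ler_nat.
apply: le_trans (_ : ((q' * F) ^ j)%N%:R * (W%:R * (2 * (G * Kt))%N%:R ^+ n) <= _).
  apply: le_trans (ler_wpM2r _ (udistX _ al1)) _; first by rewrite exprn_ge0.
  rewrite -mulrA ler_wpM2l //.
  apply: le_trans (ler_wpM2l (udist_ge0 _) Dn) _.
  by rewrite mulrCA mulrC ler_wpM2r ?exprn_ge0 // /n jj0.
rewrite -!natrX -!natrM ler_nat.
apply: leq_trans (_ : (W * k`!) ^ n * (2 * (G * Kt)) ^ n <= _)%N; last first.
  by rewrite -expnMn leq_exp2r // /K -/W; rewrite leq_eqVlt; apply/orP; left; apply/eqP; ring.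
rewrite mulnA leq_mul2r; apply/orP; right.
rewrite /n expnS mulnC leq_mul //; first by rewrite leq_pmulr // fact_gt0.
by case: (nat_of_ord j) => // j'; rewrite leq_exp2r // leq_mul.
Qed.

(** [f] is known only through [weyl_bound]; applied to an empty sum, this yields some
    [0 < q <= f (2 * T)]. *)
Lemma K_gt0 : (0 < K)%N.
Proof.
have T20 : (0 < 2 * T)%N by rewrite muln_gt0 T_gt0.
have [|q [/andP[q0 qf] _]] := f_weyl k_gt0 T20 (fun=> cnorm1 R) (cnorm1 R) (phase1 R 1) (X := 0).
  by rewrite mulr_ge0 ?cnorm_ge0.
by rewrite /K muln_gt0 muln_gt0 fact_gt0 (leq_trans q0 qf) /= muln_gt0 G_gt0.
Qed.

(** Each unresolved step adds an independent vector, and [k] degrees of rank at most [r] have room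
    for [k * r] of them, so one more step must resolve. The hypothesis is the scale that this last
    step demands. *)
Lemma resolve D : (G * K ^ (k * r) <= D)%N -> resolved D.
Proof.
move=> GD; have all_t t : (t <= (k * r).+1)%N -> resolved D \/ state D t (K ^ t).
  elim: t => [_|t IH]; first by right; rewrite expn0; apply: state0.
  rewrite ltnS => tk; have [|res|st] := IH; [exact: leqW | by left |].
  rewrite expnS; apply: state_step st; apply: leq_trans GD.
  by rewrite leq_mul2l leq_pexp2l ?orbT ?K_gt0.
have [//|/state_size] := all_t _ (leqnn _).
by rewrite ltnn.
Qed.

End Step.

(** * A positive kernel *)

Section Weights.
Variable R : rcfType.
Implicit Types x y z : R[i].

Lemma cnorm_sqr z : cnorm z ^+ 2 = complex.Re z ^+ 2 + complex.Im z ^+ 2.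
Proof. by apply: complexI; rewrite rmorphXn /= cnormE -add_Re2_Im2. Qed.

Lemma Re_le_nm z : complex.Re z <= cnorm z.
Proof.
rewrite (le_trans (ler_norm _)) // -(ler_pXn2r (ltn0Sn 1)) ?nnegrE ?cnorm_ge0 //.
by rewrite cnorm_sqr real_normK ?num_real // lerDl sqr_ge0.
Qed.

Lemma Re_sum (I : Type) (s : seq I) (P : pred I) (F : I -> R[i]) :
  complex.Re (\sum_(i <- s | P i) F i) = \sum_(i <- s | P i) complex.Re (F i).
Proof. by apply: (big_morph (@complex.Re R)) => // -[a b] [c d]. Qed.

Lemma Re_realM (a : R) z : complex.Re (a%:C%C * z) = a * complex.Re z.
Proof. by case: z => c d /=; rewrite mul0r subr0. Qed.

Lemma cnorm_half_sqr z : cnorm z = 1 -> cnorm ((1 + z) / 2) ^+ 2 = 1 - udist z ^+ 2 / 4.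
Proof.
move=> z1; have : cnorm z ^+ 2 = 1 by rewrite z1 expr1n.
rewrite cnormM cnormV cnorm_nat exprMn /udist !cnorm_sqr; case: z {z1} => a b /=.
lra.
Qed.

Lemma sum_sqr_ge (I : finType) (p : I -> R) :
  \sum_i p i = 1 -> 1 <= #|I|%:R * \sum_i p i ^+ 2.
Proof.
move=> p1; have [c0|c0] := posnP #|I|.
  by move: p1; rewrite big_pred0 => [/eqP|i]; [rewrite eq_sym oner_eq0 | have /card0_eq/(_ i) := c0].
set c : R := #|I|%:R; have c_gt0 : 0 < c by rewrite ltr0n.
have : 0 <= \sum_i (c * p i - 1) ^+ 2 by apply: sumr_ge0 => i _; apply: sqr_ge0.
have -> : \sum_i (c * p i - 1) ^+ 2 = c ^+ 2 * (\sum_i p i ^+ 2) - 2 * c * (\sum_i p i) + c.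
  rewrite !mulr_sumr -sumrB /c -[X in _ = _ + X%:R]sum1_card natr_sum -big_split /=.
  by apply: eq_bigr => i _; ring.
rewrite p1; nra.
Qed.

Lemma cnorm_weighted_sum_sqr (I : finType) (p : I -> R) (u : I -> R[i]) :
  (forall i, cnorm (u i) = 1) ->
  cnorm (\sum_i (p i)%:C%C * u i) ^+ 2 =
  \sum_i \sum_j p i * p j * complex.Re (u i / u j).
Proof.
move=> u1; set S := \sum_i (p i)%:C%C * u i.
have -> : cnorm S ^+ 2 = complex.Re (S * (S^*)%C) by rewrite -sqr_normc -cnormE -rmorphXn.
have -> : (S^*)%C = \sum_i (p i)%:C%C * (u i)^-1.
  by rewrite rmorph_sum; apply: eq_bigr => i _; rewrite rmorphM /= oppr0 conj_unit.
rewrite /S mulr_suml Re_sum; apply: eq_bigr => i _.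
rewrite mulr_sumr Re_sum; apply: eq_bigr => j _.
by rewrite mulrACA -rmorphM Re_realM.
Qed.
End Weights.

Section Kernel.
Variables (R : rcfType) (k r : nat) (z : 'I_r -> R[i]) (h : nat).
Hypotheses (z1 : forall s, cnorm (z s) = 1).
Let I := ('I_k * 'I_r)%type.
Let F := {ffun I -> 'I_h.+1}.

Let y (i : I) d := z i.2 ^+ (d ^ i.1.+1).

(** Large only where all [y i d] are close to 1, while the binomial expansion has nonnegative
    weights and exponents between 0 and [h], so that quotients of two terms have frequencies of
    height at most [h]. *)
Let kernel d := \prod_i ((1 + y i d) / 2) ^+ h.

Let weight (b : F) : R := \prod_i ('C(h, b i)%:R / 2 ^+ h).

Let term (b : F) d := \prod_i y i d ^+ b i.

Let diff (b c : F) (j : 'I_k) : 'rV[int]_r := \row_s ((b (j, s))%:Z - (c (j, s))%:Z).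

Let y_unit i d : cnorm (y i d) = 1. Proof. exact: cnorm_unitX. Qed.

Lemma binomial_weights (x : R[i]) :
  ((1 + x) / 2) ^+ h = \sum_(i < h.+1) ('C(h, i)%:R / 2 ^+ h)%:C%C * x ^+ i.
Proof.
rewrite exprMn exprDn mulr_suml; apply: eq_bigr => i _.
rewrite expr1n mul1r rmorphM fmorphV rmorphXn /= !rmorph_nat exprVn.
by rewrite -mulr_natl mulrAC.
Qed.

Lemma kernelE d : kernel d = \sum_b (weight b)%:C%C * term b d.
Proof.
rewrite /kernel; under eq_bigr do rewrite binomial_weights.
rewrite bigA_distr_bigA; apply: eq_bigr => b _.
by rewrite big_split /= /weight rmorph_prod.
Qed.

Lemma weight_ge0 b : 0 <= weight b.
Proof. by apply: prodr_ge0 => i _; rewrite divr_ge0 ?exprn_ge0. Qed.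

(** At [d = 0] all phases equal 1, hence so does the kernel, and its expansion becomes this sum. *)
Lemma sum_weight : \sum_b weight b = 1.
Proof.
have /(congr1 (@complex.Re R)) := kernelE 0.
rewrite /kernel Re_sum /term.
have e i : y i 0 = 1 by rewrite /y exp0n.
rewrite big1 => [/= ->|i _]; last by rewrite e -[1 + 1]/(2%:R) divff ?expr1n ?pnatr_eq0.
apply: eq_bigr => b _; rewrite big1 ?mulr1 // => i _.
by rewrite e expr1n.
Qed.

Lemma term_unit b d : cnorm (term b d) = 1.
Proof. by rewrite cnorm_prod big1 // => i _; rewrite cnorm_unitX. Qed.

Lemma term_div b c d : term b d / term c d = poly_phase z (diff b c) d.
Proof.
rewrite /term -prodfV -big_split /= /poly_phase.
transitivity (\prod_(j < k) \prod_(s < r) (y (j, s) d ^+ b (j, s) / y (j, s) d ^+ c (j, s))).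
  by rewrite pair_bigA; apply: eq_bigr => -[].
apply: eq_bigr => j _; rewrite -prodrXl; apply: eq_bigr => s _.
rewrite mxE expfzDr ?unit_neq0 // -exprnP -exprnN exprMn exprVn /y /=.
by rewrite -!exprM ![(d ^ j.+1 * _)%N]mulnC.
Qed.

Lemma diff_height b c j : height_le h (diff b c j).
Proof.
move=> s; rewrite mxE; have := ltn_ord (b (j, s)); have := ltn_ord (c (j, s)).
lia.
Qed.

(* The diagonal terms contribute at least [h.+1 ^ -(k * r)], the almost trivial
   ones have nonnegative real part and all others are negligible. *)
Lemma kernel_large D : resolved k z h (2 * h.+1 ^ (k * r)) D ->
  exists d, (0 < d <= D)%N /\ 1 <= (2 * h.+1 ^ (k * r))%N%:R * cnorm (kernel d) ^+ 2.
Proof.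
set T := (2 * _)%N => -[Q [X [Q0 X0 QX res]]].
have T0 : 0 < T%:R :> R by rewrite ltr0n muln_gt0 expn_gt0.
have XR : 0 < X%:R :> R by rewrite ltr0n.
have Re_ge b c : T%:R * X%:R * (b == c)%:R - X%:R <=
    T%:R * complex.Re (\sum_(x < X) term b (Q * x.+1) / term c (Q * x.+1)).
  case: eqP => [->|_].
    under eq_bigr do rewrite divff ?unit_neq0 ?term_unit //.
    by rewrite sumr_const card_ord -(rmorph_nat (real_complex R)) /= mulr1 lerBlDr lerDl.
  rewrite mulr0 add0r; under eq_bigr do rewrite term_div.
  have [near|far] := res _ (diff_height b c).
    apply: le_trans (_ : 0 <= _); first by rewrite oppr_le0.
    rewrite mulr_ge0 // Re_sum; apply: sumr_ge0 => x _.
    have := near x (ltn_ord x); rewrite /udist cnorm_distC => le.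
    have := le_trans (Re_le_nm _) le; case: (poly_phase _ _ _) => a b' /=; lra.
  rewrite lerNl; apply: le_trans far.
  rewrite -mulrN ler_wpM2l //; set S := \sum_(x < X) _.
  by rewrite -cnormN; apply: le_trans (Re_le_nm _); case: S.
have total : X%:R <= T%:R * \sum_(x < X) cnorm (kernel (Q * x.+1)) ^+ 2.
  have -> : \sum_(x < X) cnorm (kernel (Q * x.+1)) ^+ 2 =
     \sum_b \sum_c weight b * weight c *
        complex.Re (\sum_(x < X) term b (Q * x.+1) / term c (Q * x.+1)).
    transitivity (\sum_(x < X) \sum_b \sum_c weight b * weight c *
        complex.Re (term b (Q * x.+1) / term c (Q * x.+1))).
      apply: eq_bigr => x _; rewrite kernelE cnorm_weighted_sum_sqr // => b.
      exact: term_unit.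
    rewrite exchange_big; apply: eq_bigr => b _ /=.
    rewrite exchange_big; apply: eq_bigr => c _ /=.
    by rewrite Re_sum mulr_sumr.
  (* [T] is twice the number of terms, so by Cauchy-Schwarz the diagonal gives at least [2 * X]; the
     correction [- X], averaged with total weight 1, costs [X]. *)
  have -> : X%:R = 2 * X%:R - X%:R :> R by ring.
  apply: le_trans (_ : T%:R * X%:R * (\sum_b weight b ^+ 2) - X%:R <= _).
    rewrite lerD2r /T natrM -!mulrA ler_wpM2l // mulrCA ler_peMr ?(ltW XR) //.
    have := sum_sqr_ge sum_weight.
    by rewrite card_ffun card_prod !card_ord.
  have -> : T%:R * X%:R * (\sum_b weight b ^+ 2) - X%:R =
      \sum_b \sum_c weight b * weight c * (T%:R * X%:R * (b == c)%:R - X%:R).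
    have Xe : X%:R = \sum_b \sum_c weight b * weight c * X%:R :> R.
      under eq_bigr do rewrite -mulr_suml -mulr_sumr sum_weight mulr1.
      by rewrite -mulr_suml sum_weight mul1r.
    rewrite [X in _ - X = _]Xe mulr_sumr -sumrB; apply: eq_bigr => b _.
    under [RHS]eq_bigr do rewrite mulrBr.
    rewrite sumrB; congr (_ - _).
    rewrite (bigD1 b) //= eqxx big1 => [|c /negPf bc]; last by rewrite eq_sym bc !mulr0.
    by rewrite mulr1 addr0; ring.
  rewrite mulr_sumr; apply: ler_sum => b _; rewrite mulr_sumr; apply: ler_sum => c _.
  by rewrite [X in _ <= X]mulrCA ler_wpM2l ?mulr_ge0 ?weight_ge0.
have [/existsP[x big]|/existsPn no] :=
    boolP [exists x : 'I_X, 1 <= T%:R * cnorm (kernel (Q * x.+1)) ^+ 2].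
  exists (Q * x.+1)%N; rewrite muln_gt0 Q0 /=; split=> //.
  by rewrite (leq_trans _ QX) // leq_mul2l ltn_ord orbT.
move: total; rewrite leNgt => /negP[].
rewrite mulr_sumr -[X in _ < X%:R]card_ord -sum1_card natr_sum.
apply: ltr_sum => [|x _]; last by rewrite ltNge no.
by apply/hasP; exists (Ordinal X0); rewrite // mem_index_enum.
Qed.
Lemma kernel_le i d : cnorm (kernel d) ^+ 2 <= (1 - udist (y i d) ^+ 2 / 4) ^+ h.
Proof.
have le1 j : 0 <= cnorm ((1 + y j d) / 2) ^+ 2 ^+ h <= 1.
  rewrite exprn_ge0 ?sqr_ge0 // exprn_ile1 ?sqr_ge0 //.
  by rewrite cnorm_half_sqr // lerBlDr lerDl divr_ge0 ?sqr_ge0.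
rewrite -cnorm_half_sqr // cnorm_prod -prodrXl (bigD1 i) //= cnormX -!exprM mulnC ler_piMr //.
  by rewrite exprn_ge0 ?cnorm_ge0.
apply: prodr_ile1 => j _; rewrite cnormX -exprM mulnC exprM; exact: le1.
Qed.

Lemma simultaneous_return D : resolved k z h (2 * h.+1 ^ (k * r)) D ->
  exists d, (0 < d <= D)%N /\ forall s (j : 'I_k),
    1 <= (2 * h.+1 ^ (k * r))%N%:R * (1 - udist (z s ^+ (d ^ j.+1)) ^+ 2 / 4) ^+ h.
Proof.
case/kernel_large=> d [dD big]; exists d; split=> // s j.
by apply: le_trans big _; rewrite ler_wpM2l // (kernel_le (j, s)).
Qed.

End Kernel.

(** * Simultaneous polynomial recurrence *)

(* At most exponential in [r * ln r]. *)
Definition fact_bounded (f : nat -> nat) :=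
  exists E, (0 < E)%N /\ forall r, (f r <= (E * r.+1) ^ (E * r.+1))%N.

Lemma fact_boundedM f g :
  fact_bounded f -> fact_bounded g -> fact_bounded (fun r => f r * g r)%N.
Proof.
case=> C [C0 fC] [D [D0 gD]]; exists (C + D)%N; split=> [|r]; first by rewrite addn_gt0 C0.
apply: leq_trans (leq_mul (fC _) (gD _)) _.
rewrite [X in (_ <= _ ^ X)%N]mulnDl expnD leq_mul // leq_exp2r ?muln_gt0 ?C0 ?D0 //.
  by rewrite leq_mul2r leq_addr orbT.
by rewrite leq_mul2r leq_addl orbT.
Qed.

(** The argument [r.+1] avoids 0, about which [poly_bounded] says nothing. *)
Lemma fact_bounded_poly p : poly_bounded p -> fact_bounded (fun r => p r.+1 ^ r)%N.
Proof.
case=> C pC; exists C.+1; split=> // r.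
apply: leq_trans (_ : ((C.+1 * r.+1) ^ C.+1) ^ r <= _)%N.
  case: r => // r; rewrite leq_exp2r //; apply: leq_trans (pC _ _) _ => //.
  rewrite expnMn leq_mul ?leq_pexp2l //.
  by rewrite (leq_trans (leqnSn C)) // -{1}[C.+1]expn1 leq_pexp2l.
by rewrite -expnM leq_pexp2l // leq_mul.
Qed.

Lemma fact_bounded_const c : fact_bounded (fun=> c).
Proof.
exists c.+1; split=> // r.
rewrite (leq_trans (leqnSn c)) // -{1}[c.+1]expn1.
by rewrite (leq_trans (_ : _ <= (c.+1 * r.+1) ^ 1)%N) ?leq_pexp2l // leq_exp2r // leq_pmulr.
Qed.

Lemma fact_boundedX f n : fact_bounded f -> fact_bounded (fun r => f r ^ n)%N.
Proof.
move=> pf; elim: n => [|n IH]; first exact: fact_bounded_const.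
by have [E [E0 fE]] := fact_boundedM pf IH; exists E; split=> // r; rewrite expnS fE.
Qed.

Lemma fact_bounded_comp p f : (forall r, 0 < f r)%N ->
  poly_bounded p -> fact_bounded f -> fact_bounded (p \o f).
Proof.
move=> f0 [C pC] ff.
have [E [E0 fE]] := fact_boundedM (fact_bounded_const C) (fact_boundedX C ff).
by exists E; split=> // r; apply: leq_trans (pC _ (f0 r)) (fE r).
Qed.

Lemma fact_bounded_succ : fact_bounded S.
Proof.
exists 1%N; split=> // r; rewrite mul1n -{1}[r.+1]expn1.
by rewrite leq_pexp2l.
Qed.

Lemma fact_bounded_fact : fact_bounded factorial.
Proof.
exists 1%N; split=> // r; rewrite mul1n.
apply: leq_trans (leq_pexp2l (ltn0Sn r) (leqnSn r)).
elim: r => // r IH; rewrite factS expnS leq_mul //.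
by apply: leq_trans IH _; case: (r) => // n; rewrite leq_exp2r.
Qed.

(** Resolves a circularity: the kernel exponent is [h = g * e] with [T < 2 ^ e], while
    [T = 2 * h.+1 ^ n] depends on [h]. Since [ln T] is only of order [n ln h], an [e] quadratic in
    [n] suffices. *)
Lemma binary_growth (g n : nat) : (0 < n)%N ->
  (2 * (g * ((2 * g + 8) * n ^ 2)).+1 ^ n < 2 ^ ((2 * g + 8) * n ^ 2))%N.
Proof.
move=> n0; set e := ((2 * g + 8) * n ^ 2)%N.
apply: leq_trans (_ : (2 * (g * e).+1).+1 ^ n <= _)%N.
  apply: leq_trans (_ : (2 * (g * e).+1) ^ n < _)%N; last by rewrite ltn_exp2r.
  by rewrite ltnS expnMn leq_mul2r -{1}[2%N]expn1 leq_pexp2l ?orbT.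
have -> : (2 ^ e = (2 ^ ((2 * g + 8) * n)) ^ n)%N by rewrite -expnM /e -mulnA.
rewrite leq_exp2r // mulnDl expnD !expnM.
have le_exp x : (x < 2 ^ x)%N by apply: ltn_expl.
have g1 : (g.+1 <= 2 ^ g)%N := le_exp g.
have n1 : (n.+1 <= 2 ^ n)%N := le_exp n.
have A : (g.+1 ^ 2 <= ((2 ^ 2) ^ g) ^ n)%N.
  apply: leq_trans (_ : (2 ^ 2) ^ g <= _)%N; first by rewrite -expnM mulnC expnM leq_exp2r.
  by rewrite -[X in (X <= _)%N]expn1 leq_pexp2l // expn_gt0.
have B : (n.+1 ^ 8 <= (2 ^ 8) ^ n)%N by rewrite -expnM mulnC expnM leq_exp2r.
apply: leq_trans (leq_mul A B); rewrite /e.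
have n4 : (2 ^ 6 * n.+1 ^ 2 <= n.+1 ^ 8)%N.
  by rewrite [(_ ^ 8)%N](expnD n.+1 6 2) leq_mul2r leq_exp2r // ltnS n0 orbT.
apply: leq_trans (leq_mul (leqnn _) n4).
rewrite -[(2 ^ 6)%N]/64%N !expnS !expn0; nia.
Qed.

Section RecurrenceTheorem.
Variable R : rcfType.

Lemma weyl_bound_le k f f' : (forall T, f T <= f' T)%N ->
  weyl_bound R k f -> weyl_bound R k f'.
Proof.
move=> ff' wf T X a phi T0 phi1 a1 ph big.
have [q [/andP[q0 qf] qP]] := wf T X a phi T0 phi1 a1 ph big.
exists q; rewrite q0 (leq_trans qf) //; split=> //.
by apply: le_trans qP _; rewrite ler_nat.
Qed.

Lemma weyl_uniform k : exists f, poly_bounded f /\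
  forall j, (j < k)%N -> weyl_bound R j.+1 f.
Proof.
elim: k => [|k [f [pf fP]]]; first by exists id; split=> //; exact: poly_bounded_id.
have [f' [pf' f'P]] := weyl R (ltn0Sn k).
exists (fun T => f T + f' T)%N; split; first exact: poly_boundedD.
move=> j; rewrite ltnS leq_eqVlt => /orP[/eqP ->|jk].
  by apply: weyl_bound_le f'P => T; apply: leq_addl.
by apply: weyl_bound_le (fP j jk) => T; apply: leq_addr.
Qed.

(** Bernoulli's inequality bounds the power [g] of [1 + 1/g] below by 2, and its product with the
    left side is at most 1. *)
Lemma half_power (g : nat) : (0 < g)%N -> (1 - g%:R^-1) ^+ g <= 2^-1 :> R.
Proof.
move=> g0; have gR : 0 < g%:R :> R by rewrite ltr0n.
have gi : g%:R^-1 <= 1 :> R by rewrite invf_le1 // ler1n.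
have ge2 : 2 <= (1 + g%:R^-1) ^+ g :> R.
  have bern n (x : R) : 0 <= x -> 1 + n%:R * x <= (1 + x) ^+ n.
    move=> x0; elim: n => [|n IH]; first by rewrite mul0r addr0 expr0.
    have n0 : 0 <= n%:R :> R by [].
    rewrite exprS -natr1; nra.
  apply: le_trans (bern g _ _); last by rewrite invr_ge0 ltW.
  by rewrite divff ?gt_eqF.
have prod : (1 - g%:R^-1) ^+ g * (1 + g%:R^-1) ^+ g <= 1 :> R.
  rewrite -exprMn exprn_ile1 //.
    by rewrite mulr_ge0 ?subr_ge0 ?addr_ge0 // invr_ge0 ltW.
  have : 0 <= (g%:R^-1 : R) ^+ 2 by rewrite sqr_ge0.
  nra.
have : 0 <= (1 - g%:R^-1) ^+ g :> R by rewrite exprn_ge0 // subr_ge0.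
rewrite -[2^-1]mul1r ler_pdivlMr //; nra.
Qed.

(** If [v > 1 / m], then [1 - v ^ 2 / 4] is at most [1 - 1 / (4 * m ^ 2)], whose power [4 * m ^ 2]
    is at most 1/2; raising this to the power [e] beats [T]. *)
Lemma small_of_large_power (m e T : nat) (v : R) : (0 < m)%N -> 0 <= v <= 2 ->
  (T < 2 ^ e)%N -> 1 <= T%:R * (1 - v ^+ 2 / 4) ^+ (4 * m ^ 2 * e) ->
  v * m%:R <= 1.
Proof.
move=> m0 /andP[v0 v2] Te big; have [//|vm] := lerP (v * m%:R) 1.
suff : T%:R * (1 - v ^+ 2 / 4) ^+ (4 * m ^ 2 * e) < 1 by rewrite ltNge big.
set g := (4 * m ^ 2)%N; have g0 : (0 < g)%N by rewrite muln_gt0 expn_gt0 m0.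
have gR : 0 < g%:R :> R by rewrite ltr0n.
have step : 0 <= 1 - v ^+ 2 / 4 <= 1 - g%:R^-1.
  apply/andP; split; first by nra.
  rewrite lerD2l lerN2 -[_^-1]mul1r ler_pdivrMr // /g natrM natrX; nra.
apply: le_lt_trans (_ : T%:R * 2^-1 ^+ e < 1); last first.
  by rewrite exprVn ltr_pdivrMr ?exprn_gt0 // mul1r -natrX ltr_nat.
rewrite ler_wpM2l // exprM lerXn2r ?nnegrE ?exprn_ge0 ?invr_ge0 //.
  by case/andP: step.
apply: le_trans (half_power g0); case/andP: step => s0 s1.
by rewrite lerXn2r ?nnegrE // (le_trans s0).
Qed.

(** [h r] is quadratic in [r], so [T], [Delta], [G] and [K] are all [exp(O(r log r))]; the [k * r]
    steps turn this into an exponent of order [r ^ 2]. *)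
Theorem recurrence (k m : nat) : (0 < k)%N -> (0 < m)%N ->
  exists E, (0 < E)%N /\ forall r (z : 'I_r -> R[i]) D,
    (forall s, cnorm (z s) = 1) -> ((E * r.+1) ^ (E * r.+1 ^ 2) <= D)%N ->
    exists d, (0 < d <= D)%N /\
      forall s j, (j < k)%N -> udist (z s ^+ (d ^ j.+1)) * m%:R <= 1.
Proof.
move=> k0 m0; have [f [pf fP]] := weyl_uniform k.
pose g := (4 * m ^ 2)%N.
pose h r := (g * ((2 * g + 8) * (k * r) ^ 2))%N.
pose T r := (2 * (h r).+1 ^ (k * r))%N.
pose Delta r := (r`! * h r ^ r)%N.
pose G r := (Delta r ^ k * (r.+1 * Delta r) * (2 * k * T r))%N.
pose K r := (f (2 * T r) * k`! * (2 * G r))%N.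
have pc := poly_bounded_const; have fc := fact_bounded_const.
have ph : poly_bounded h.
  apply: poly_boundedM (pc g) (poly_boundedM (pc (2 * g + 8)%N) _).
  exact: poly_boundedX (poly_boundedM (pc k) poly_bounded_id).
have h_le r : (h r <= h r.+1)%N by rewrite /h !leq_mul // leq_exp2r // leq_mul.
have fT : fact_bounded T.
  apply: fact_boundedM (fc 2) _.
  have pk : poly_bounded (fun r => (h r).+1 ^ k)%N.
    have := poly_boundedX k (poly_boundedD (pc 1%N) ph).
    by case=> C hC; exists C => r r0; rewrite -add1n hC.
  have [E [E0 EP]] := fact_bounded_poly pk; exists E; split=> // r.
  apply: leq_trans (EP r); rewrite expnM; case: r => // r.
  by rewrite leq_exp2r // leq_exp2r // ltnS.
have fD : fact_bounded Delta.
  apply: fact_boundedM fact_bounded_fact _.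
  have [E [E0 EP]] := fact_bounded_poly ph; exists E; split=> // r.
  apply: leq_trans (EP r); case: r => // r.
  by rewrite leq_exp2r.
have fG : fact_bounded G.
  apply: fact_boundedM (fact_boundedM (fc _) fT).
  exact: fact_boundedM (fact_boundedX k fD) (fact_boundedM fact_bounded_succ fD).
have fK : fact_bounded K.
  apply: fact_boundedM (fact_boundedM (fc 2) fG).
  apply: fact_boundedM (fc _).
  apply: fact_bounded_comp pf (fact_boundedM (fc 2) fT) => r.
  by rewrite !muln_gt0 expn_gt0.
have [E [E0 EP]] := fact_boundedM fG (fact_boundedX k fK).
exists E; split=> // r z D z1 ED.
have [r0|r0] := posnP r.
  exists 1%N; split; last by move=> s; have := ltn_ord s; rewrite {2}r0.
  by apply: leq_trans ED; rewrite expn_gt0 muln_gt0 E0.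
have n0 : (0 < k * r)%N by rewrite muln_gt0 k0.
have h0 : (0 < h r)%N by rewrite !muln_gt0 k0 r0 m0 addn_gt0 orbT.
have T0 : (0 < T r)%N by rewrite muln_gt0 expn_gt0.
have GD : (G r * K r ^ (k * r) <= D)%N.
  apply: leq_trans ED; rewrite -mulnn mulnA expnM [in X in (_ <= X)%N]expnM.
  apply: leq_trans (_ : (G r * K r ^ k) ^ r.+1 <= _)%N; last by rewrite leq_exp2r.
  have [->|G0] := posnP (G r); first by rewrite mul0n.
  have [->|K0] := posnP (K r); first by rewrite !exp0n // muln0.
  rewrite expnMn leq_mul ?leq_pexp2l ?expn_gt0 ?K0 //.
  by rewrite -[X in (X <= _)%N]expn1 leq_pexp2l.
have [d [dD dP]] := simultaneous_return z1 (resolve k0 z1 h0 T0 fP GD).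
exists d; split=> // s j jk.
apply: (small_of_large_power m0 _ (binary_growth g n0) (dP s (Ordinal jk))).
by rewrite udist_ge0 udist_le2 // cnorm_unitX.
Qed.
End RecurrenceTheorem.

(** * Fourier analysis of sumsets *)

Section Fourier.
Variables (R : rcfType) (V : finComNzRingType) (chi : V -> R[i]).
Hypotheses (chiD : forall x y, chi (x + y) = chi x * chi y)
  (chi1 : forall x, cnorm (chi x) = 1)
  (chi_orth : forall t, t != 0 -> \sum_xi chi (xi * t) = 0).
Implicit Types (F : V -> R[i]) (A B : {set V}) (t xi x : V).

Lemma chi0 : chi 0 = 1.
Proof.
have := chiD 0 0; rewrite addr0 -[LHS]mulr1 => /mulfI -> //.
exact: unit_neq0.
Qed.

Lemma chiN x : chi (- x) = (chi x)^-1.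
Proof.
apply: (mulfI (unit_neq0 (chi1 x))).
by rewrite -chiD subrr chi0 divff // unit_neq0.
Qed.

(** The ring structure yields a character [x -> chi (xi * x)] for each [xi] from the single
    [chi]. *)
Definition fourier F xi := \sum_x F x * chi (xi * x).

Lemma parseval F :
  \sum_xi cnorm (fourier F xi) ^+ 2 = #|V|%:R * \sum_x cnorm (F x) ^+ 2.
Proof.
apply: (@complexI R); rewrite rmorphM rmorph_nat !rmorph_sum /=.
have sq z : (cnorm z ^+ 2)%:C%C = z * (z^*)%C by rewrite rmorphXn /= cnormE sqr_normc.
under eq_bigr do rewrite sq; under [in RHS]eq_bigr do rewrite sq.
transitivity (\sum_x \sum_y F x * ((F y)^*)%C * \sum_xi chi (xi * (x - y))).
  have -> : \sum_xi fourier F xi * ((fourier F xi)^*)%C =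
      \sum_xi \sum_x \sum_y F x * ((F y)^*)%C * chi (xi * (x - y)).
    apply: eq_bigr => xi _; rewrite /fourier mulr_suml; apply: eq_bigr => x _.
    rewrite rmorph_sum mulr_sumr; apply: eq_bigr => y _.
    by rewrite rmorphM /= (conj_unit (chi1 _)) mulrBr chiD chiN mulrACA.
  rewrite exchange_big; apply: eq_bigr => x _ /=.
  by rewrite exchange_big; apply: eq_bigr => y _ /=; rewrite mulr_sumr.
rewrite mulr_sumr; apply: eq_bigr => x _.
rewrite (bigD1 x) //= subrr [X in _ + X]big1 ?addr0 => [|y yx].
  under eq_bigr do rewrite mulr0 chi0.
  by rewrite sumr_const mulrC.
by rewrite chi_orth ?mulr0 // subr_eq0 eq_sym.
Qed.

Definition set_fourier A xi := \sum_(a in A) chi (xi * a).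

Definition sum_count A B x : R[i] := \sum_(a in A) \sum_(b in B) (a + b == x)%:R.

Lemma fourier_indicator A xi :
  fourier (fun x => (x \in A)%:R) xi = set_fourier A xi.
Proof.
rewrite /fourier /set_fourier [RHS]big_mkcond; apply: eq_bigr => x _.
by case: ifP; rewrite (mul1r, mul0r).
Qed.

Lemma parseval_set A : \sum_xi cnorm (set_fourier A xi) ^+ 2 = #|V|%:R * #|A|%:R.
Proof.
under eq_bigr do rewrite -fourier_indicator.
rewrite parseval -sum1_card natr_sum [in RHS]big_mkcond; congr (_ * _).
by apply: eq_bigr => x _; case: ifP; rewrite (cnorm1, cnorm0) (expr1n, expr0n).
Qed.

Lemma fourier_sum_count A B xi :
  fourier (sum_count A B) xi = set_fourier A xi * set_fourier B xi.
Proof.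
rewrite /fourier /set_fourier /sum_count mulr_suml.
under eq_bigr do rewrite mulr_suml.
rewrite exchange_big; apply: eq_bigr => a aA /=.
under eq_bigr do rewrite mulr_suml.
rewrite mulr_sumr exchange_big; apply: eq_bigr => b bB /=.
rewrite (bigD1 (a + b)) //= eqxx mul1r big1 ?addr0; first by rewrite mulrDr chiD.
by move=> x /negPf; rewrite eq_sym => ->; rewrite mul0r.
Qed.

Lemma fourier_shift F t xi :
  fourier (fun x => F (x + t) - F x) xi = ((chi (xi * t))^-1 - 1) * fourier F xi.
Proof.
rewrite mulrBl mul1r /fourier; under eq_bigr do rewrite mulrBl.
rewrite sumrB; congr (_ - _).
rewrite (reindex_inj (addIr (- t))) mulr_sumr; apply: eq_bigr => x _.
by rewrite subrK mulrBr chiD chiN; ring.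
Qed.

Lemma sum_count_neq0 A B x : sum_count A B x != 0 ->
  exists a b, [/\ a \in A, b \in B & x = a + b].
Proof.
move=> nz; have [/existsP[a /existsP[b /and3P[aA bB /eqP ->]]]|no] :=
    boolP [exists a, exists b, [&& a \in A, b \in B & x == a + b]].
  by exists a, b.
case/eqP: nz; rewrite /sum_count big1 // => a aA; rewrite big1 // => b bB.
case: eqP => // e; move/existsPn: no => /(_ a)/existsPn/(_ b).
by rewrite aA bB e eqxx.
Qed.
Definition spectrum A (eta : R) := [set xi | eta <= cnorm (set_fourier A xi) ^+ 2].

Lemma card_spectrum A (eta : R) : #|spectrum A eta|%:R * eta <= #|V|%:R * #|A|%:R.
Proof.
rewrite -parseval_set -sum1_card natr_sum mulr_suml [X in X <= _]big_mkcond.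
by apply: ler_sum => xi _; rewrite inE; case: ifP; rewrite ?mul1r ?sqr_ge0.
Qed.

(** By Parseval: on the spectrum the squared multiplier of the shift is at most [c]; off it the
    multiplier is at most 4, the transform of [A] contributes less than [eta], and that of [B] is
    summed exactly. *)
Lemma shift_energy A B t (eta c : R) : 0 <= c -> 0 <= eta ->
  (forall xi, xi \in spectrum A eta -> udist (chi (xi * t)) ^+ 2 <= c) ->
  \sum_x cnorm (sum_count A B (x + t) - sum_count A B x) ^+ 2 <=
    c * (\sum_x cnorm (sum_count A B x) ^+ 2) + 4 * eta * #|B|%:R.
Proof.
move=> c0 eta0 sp; have V0 : 0 < #|V|%:R :> R by rewrite ltr0n; apply/card_gt0P; exists 0.
rewrite -(ler_pM2l V0) -(parseval (fun x => sum_count A B (x + t) - _)).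
rewrite mulrDr mulrCA -parseval [#|V|%:R * _]mulrCA -parseval_set !mulr_sumr -big_split.
apply: ler_sum => xi _; rewrite fourier_shift cnormM exprMn fourier_sum_count cnormM exprMn /=.
rewrite -/(udist _) udistV // mulrA.
set a := cnorm (set_fourier A xi) ^+ 2; set b := cnorm (set_fourier B xi) ^+ 2.
have b0 : 0 <= b by apply: sqr_ge0.
have a0 : 0 <= a by apply: sqr_ge0.
rewrite [c * _]mulrA -mulrDl ler_wpM2r //.
have [big|small] := lerP eta a.
  by apply: ler_wpDr; rewrite ?mulr_ge0 // ler_wpM2r // sp // inE.
have udist4 : udist (chi (xi * t)) ^+ 2 <= 4.
  by have := udist_le2 (chi1 (xi * t)); have := udist_ge0 (chi (xi * t)); nra.
apply: ler_wpDl; first by rewrite mulr_ge0.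
by rewrite ler_pM ?sqr_ge0 // ltW.
Qed.

(** The zero frequency alone gives this in Parseval's identity. *)
Lemma sum_count_energy A B :
  (#|A|%:R * #|B|%:R) ^+ 2 <= #|V|%:R * \sum_x cnorm (sum_count A B x) ^+ 2.
Proof.
rewrite -parseval (bigD1 0) //= fourier_sum_count.
have card0 (S : {set V}) : set_fourier S 0 = #|S|%:R.
  rewrite /set_fourier; under eq_bigr do rewrite mul0r chi0.
  by rewrite sumr_const.
rewrite !card0 cnormM !cnorm_nat lerDl; apply: sumr_ge0 => xi _; exact: sqr_ge0.
Qed.

(** Let [S] be the energy of [sum_count A B]. The threshold makes frequencies off the spectrum cost
    at most [S / (4 * l)] per shift, and those in it cost no more, so all [l] shifts together cost
    at most [S / 2]. If at every point of the support some shift vanished, they would cost at least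
    [S]. *)
Lemma common_shifts A B (l : nat) (t : 'I_l -> V) : (0 < l)%N ->
  A != set0 -> B != set0 ->
  (forall xi i, xi \in spectrum A (#|A|%:R ^+ 2 * #|B|%:R / (16 * l%:R * #|V|%:R)) ->
    udist (chi (xi * t i)) * (2 * l%:R) <= 1) ->
  exists x, sum_count A B x != 0 /\ forall i, sum_count A B (x + t i) != 0.
Proof.
move=> l0; rewrite -!card_gt0 => A0 B0; set eta := _ / _ => sp.
have V0 : 0 < #|V|%:R :> R by rewrite ltr0n; apply/card_gt0P; exists 0.
have AR : 0 < #|A|%:R :> R by rewrite ltr0n.
have BR : 0 < #|B|%:R :> R by rewrite ltr0n.
have lR : 1 <= l%:R :> R by rewrite ler1n.
have l0R : 0 < l%:R :> R by rewrite ltr0n.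
set f := sum_count A B; pose S := \sum_x cnorm (f x) ^+ 2.
have S_large := sum_count_energy A B; rewrite -/f -/S in S_large.
have S0 : 0 < S.
  by rewrite -(pmulr_rgt0 _ V0) (lt_le_trans _ S_large) // exprn_gt0 // mulr_gt0.
have eta0 : 0 < eta by rewrite divr_gt0 ?mulr_gt0 ?exprn_gt0.
have energy i : \sum_x cnorm (f (x + t i) - f x) ^+ 2 <= (2 * l%:R)^-1 * S.
  apply: le_trans (shift_energy B (c := (4 * l%:R)^-1) _ (ltW eta0) _) _.
  - by rewrite invr_ge0 mulr_ge0.
  - move=> xi /(sp xi i) le; have := udist_ge0 (chi (xi * t i)) => v0.
    rewrite -[_^-1]mul1r ler_pdivlMr ?mulr_gt0 //; nra.
  have -> : (2 * l%:R)^-1 * S = (4 * l%:R)^-1 * S + (4 * l%:R)^-1 * S.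
    by field; rewrite (lt0r_neq0 l0R).
  have -> : 4 * eta * #|B|%:R = (4 * l%:R)^-1 * ((#|A|%:R * #|B|%:R) ^+ 2 / #|V|%:R).
    by rewrite /eta; field; rewrite (lt0r_neq0 l0R) (lt0r_neq0 V0).
  rewrite lerD2l ler_wpM2l ?invr_ge0 ?mulr_ge0 //.
  by rewrite ler_pdivrMr // [S * _]mulrC.
have [/existsP[x /andP[fx /forallP ft]]|no] :=
    boolP [exists x, (f x != 0) && [forall i, f (x + t i) != 0]].
  by exists x.
suff : S <= S / 2 by lra.
apply: le_trans (_ : \sum_x \sum_i cnorm (f (x + t i) - f x) ^+ 2 <= _).
  apply: ler_sum => x _; have [fx0|fx0] := eqVneq (f x) 0.
    by rewrite fx0 cnorm0 expr0n sumr_ge0 // => i _; apply: sqr_ge0.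
  have [/existsP[i /eqP fi]|/existsPn none] := boolP [exists i, f (x + t i) == 0]; last first.
    by case/existsP: no; exists x; rewrite fx0; apply/forallP => i; apply: none.
  rewrite (bigD1 i) //= fi sub0r cnormN lerDl sumr_ge0 // => j _; exact: sqr_ge0.
rewrite exchange_big; apply: le_trans (ler_sum _ (fun i _ => energy i)) _.
rewrite sumr_const card_ord -[X in X <= _]mulr_natl le_eqVlt; apply/orP; left; apply/eqP.
by field; rewrite (lt0r_neq0 l0R).
Qed.
End Fourier.

(** * From residues to integers *)

Section Characters.
Variables (R : rcfType) (p : nat).
Notation V := 'I_p.+2.

(** ['X^n - 1] is separable and splits over the algebraically closed [R[i]], which provides [n]
    distinct roots of unity. *)
Lemma complex_prim_root n : (0 < n)%N -> exists z : R[i], n.-primitive_root z.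
Proof.
move=> n0; have [s Ds] := closed_field_poly_normal ('X^n - 1 : {poly R[i]}).
rewrite (monicP _) ?monicXnsubC // scale1r in Ds.
have s_root : all n.-unity_root s by apply/allP => z; rewrite -root_prod_XsubC -Ds.
have s_size : (n <= size s)%N.
  by rewrite -ltnS -(size_prod_XsubC s id) -Ds size_XnsubC.
have s_uniq : uniq s.
  by rewrite -separable_prod_XsubC -Ds separable_Xn_sub_1 // pnatr_eq0 -lt0n.
by have /hasP[z _ zP] := has_prim_root n0 s_root s_uniq s_size; exists z.
Qed.

Lemma exists_character : exists chi : V -> R[i],
  [/\ forall x y, chi (x + y) = chi x * chi y, forall x, cnorm (chi x) = 1 &
      forall t, t != 0 -> \sum_xi chi (xi * t) = 0].
Proof.
have [w wP] := complex_prim_root (ltn0Sn p.+1).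
pose chi (x : V) := w ^+ x.
have D x y : chi (x + y) = chi x * chi y by rewrite /chi /= (prim_expr_mod wP) exprD.
exists chi; split=> // [x|t t0].
  apply: cnorm_unitX; apply/eqP.
  by rewrite -(pexpr_eq1 (ltn0Sn p.+1)) ?cnorm_ge0 // -cnormX (prim_expr_order wP) cnorm1.
set S := \sum_xi _.
have ct : chi t != 1.
  rewrite /chi -(prim_order_dvd wP); apply: contra t0 => /dvdnP[[|c] tc].
    by apply/eqP/val_inj; rewrite /= tc.
  by have := ltn_ord t; rewrite tc mulSn ltnNge leq_addr.
(* Translating [xi] by 1 multiplies the sum by [chi t], which differs from 1. *)
have : chi t * S = S.
  rewrite /S [RHS](reindex_inj (addIr 1)) mulr_sumr; apply: eq_bigr => xi _.
  by rewrite mulrDl mul1r D mulrC.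
move/eqP; rewrite -subr_eq0 -{2}[S]mul1r -mulrBl mulf_eq0 subr_eq0 (negPf ct) /=.
by move/eqP.
Qed.

Lemma character_intz (chi : V -> R[i]) (x : V) (n : int) :
  (forall x y, chi (x + y) = chi x * chi y) -> (forall x, cnorm (chi x) = 1) ->
  chi (x * n%:~R) = chi x ^ n.
Proof.
move=> D u; have nat_case m : chi (x *+ m) = chi x ^+ m.
  by elim: m => [|m IH]; rewrite ?mulr0n ?(chi0 D u) // mulrS exprS D IH.
by rewrite mulrzr; case: n => n; rewrite ?NegzE ?mulrNz ?(chiN D u) -pmulrn nat_case -?exprnN -?exprnP.
Qed.

Lemma small_int_eq0 (n : int) : (`|n| < p.+2)%N -> (n%:~R : V) = 0 -> n = 0.
Proof.
have nat_case (m : nat) : (m < p.+2)%N -> (m%:R : V) = 0 -> m = 0%N.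
  by move=> mp /(congr1 val); rewrite Zp_nat /= modn_small.
case: n => n /= np; first by move=> /(nat_case _ np) ->.
by rewrite NegzE intrN => /eqP; rewrite oppr_eq0 => /eqP /(nat_case n.+1 np).
Qed.

Definition residues (A : {fset int}) : {set V} := [set x | (val x)%:Z \in A].

Lemma card_residues (A : {fset int}) : (forall a, a \in A -> 0 <= a < p.+2%:Z) ->
  #|residues A| = #|` A|.
Proof.
move=> Ap; rewrite cardE -(size_map (fun x : V => (val x)%:Z)).
apply/perm_size/uniq_perm; rewrite ?fset_uniq //.
  by rewrite map_inj_uniq ?enum_uniq // => x y [/val_inj].
move=> a; apply/mapP/idP => [[x]|aA]; first by rewrite mem_enum inE => xA ->.
have := Ap _ aA; case: a aA => // a aA /andP[_ ap].
by exists (Ordinal (ap : (a < p.+2)%N)); rewrite // mem_enum inE.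
Qed.
End Characters.

Section Transfer.
Variable R : rcfType.

(** Sums are at most [2 * N] and shifts at most [N], so two congruent values differ by less than the
    modulus [4 * N] and are equal as integers. *)
Lemma sumset_of_residues (N p l : nat) (A B : {fset int}) (t : 'I_l -> int) (x : 'I_p.+2) :
  (forall a, a \in A -> 1 <= a <= N%:Z) -> (forall b, b \in B -> 1 <= b <= N%:Z) ->
  p.+2 = (4 * N)%N -> (forall i, `|t i| <= N%:Z) ->
  let f := sum_count R (residues p A) (residues p B) in
  f x != 0 -> (forall i, f (x + (t i)%:~R) != 0) ->
  exists2 m, 2 <= m <= (2 * N)%N%:Z & forall i, m + t i \in sumset A B.
Proof.
move=> hA hB pN tN f /sum_count_neq0[a [b [aA bB xab]]] ft.
rewrite !inE in aA bB; have a_bd := hA _ aA; have b_bd := hB _ bB.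
exists ((val a)%:Z + (val b)%:Z); first by lia.
move=> i; have /sum_count_neq0[a' [b' [a'A b'B e]]] := ft i.
rewrite !inE in a'A b'B; have a'_bd := hA _ a'A; have b'_bd := hB _ b'B.
have ti := tN i.
suff -> : (val a)%:Z + (val b)%:Z + t i = (val a')%:Z + (val b')%:Z.
  by apply: in_imfset2.
apply/eqP; rewrite -subr_eq0; apply/eqP; apply: (@small_int_eq0 p); first by lia.
have valz (c : 'I_p.+2) : ((val c)%:Z%:~R : 'I_p.+2) = c.
  by rewrite -pmulrn natr_Zp.
by rewrite intrB !intrD !valz -xab e subrr.
Qed.

Lemma natz_exp (d n : nat) : d%:Z ^+ n = (d ^ n)%N%:Z.
Proof. by rewrite -!natz natrX. Qed.

Section Polynomials.
Variables (l : nat) (P : 'I_l -> {poly int}) (k : nat).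
Hypotheses (P0 : forall i, (P i).[0] = 0) (Pk : forall i, (size (P i) <= k.+1)%N).

Definition coef_sum := (\sum_i \sum_(j < k) absz ((P i)`_j.+1)%R)%N.

Lemma poly_eval i (d : int) : (P i).[d] = \sum_(j < k) (P i)`_j.+1 * d ^+ j.+1.
Proof.
by rewrite (horner_coef_wide _ (Pk i)) big_ord_recl /= -horner_coef0 P0 mul0r add0r.
Qed.

Lemma coef_sum_ge i : (\sum_(j < k) absz ((P i)`_j.+1)%R <= coef_sum)%N.
Proof. by rewrite /coef_sum (bigD1 i) //= leq_addr. Qed.

Lemma poly_eval_bound i (d : nat) : (0 < d)%N ->
  `|(P i).[d%:Z]| <= (coef_sum * d ^ k)%N%:Z.
Proof.
move=> d0; rewrite poly_eval; apply: le_trans (ler_norm_sum _ _ _) _.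
apply: le_trans (_ : \sum_(j < k) (absz ((P i)`_j.+1)%R * d ^ k)%N%:Z <= _).
  apply: ler_sum => j _; rewrite normrM PoszM abszE ler_wpM2l //.
  by rewrite natz_exp ger0_norm // lez_nat leq_pexp2l.
under eq_bigr do rewrite -natz.
by rewrite -natz -natr_sum ler_nat -big_distrl leq_mul2r coef_sum_ge orbT.
Qed.

Lemma udist_poly_eval (z : R[i]) i (d : nat) (e : R) : cnorm z = 1 -> 0 <= e ->
  (forall j, (j < k)%N -> udist (z ^+ (d ^ j.+1)) <= e) ->
  udist (z ^ (P i).[d%:Z]) <= coef_sum%:R * e.
Proof.
move=> z1 e0 ze; rewrite poly_eval.
have z0 := unit_neq0 z1.
have -> : z ^ (\sum_(j < k) (P i)`_j.+1 * d%:Z ^+ j.+1) =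
    \prod_(j < k) (z ^+ (d ^ j.+1)) ^ (P i)`_j.+1.
  rewrite (big_morph (exprz z) (fun m n => expfzDr m n z0) (expr0z z)).
  apply: eq_bigr => j _; rewrite [z ^+ _]exprnP exprz_exp mulrC; congr (_ ^ (_ * _)).
  by rewrite natz_exp.
apply: le_trans (udist_prod _ _) _ => [j _|]; first by rewrite cnorm_unitz // cnorm_unitX.
apply: le_trans (_ : \sum_(j < k) (absz ((P i)`_j.+1)%R)%:R * e <= _).
  apply: ler_sum => j _; apply: le_trans (udist_exprz _ _) _; first by rewrite cnorm_unitX.
  by rewrite ler_wpM2l // ze.
by rewrite -mulr_suml -natr_sum ler_wpM2r // ler_nat coef_sum_ge.
Qed.

End Polynomials.
End Transfer.

Definition config_free (l : nat) (P : 'I_l -> {poly int}) (N : nat) (A B : {fset int}) :=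
  ~ (exists d m : int,
       [/\ d != 0, 2 <= m <= (2 * N)%N%:Z &
           translate m (poly_values P d) `<=` sumset A B]).

Lemma not_config_free (l : nat) (P : 'I_l -> {poly int}) N A B (d m : int) :
  config_free P N A B -> d != 0 -> 2 <= m <= (2 * N)%N%:Z ->
  (forall i, m + (P i).[d] \in sumset A B) -> False.
Proof.
move=> cf d0 mN AB; apply: cf; exists d, m; split=> //.
apply/fsubsetP => x /imfsetP[v /= /imfsetP[i /= _ ->] ->]; exact: AB.
Qed.

Section Core.
Variable R : rcfType.

Lemma config_free_bound (l : nat) (P : 'I_l -> {poly int}) (k : nat) :
  (0 < l)%N -> (0 < k)%N ->
  (forall i, (P i).[0] = 0) -> (forall i, (size (P i) <= k.+1)%N) ->
  exists E, (0 < E)%N /\ forall N (A B : {fset int}) r,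
    (forall a, a \in A -> 1 <= a <= N%:Z) -> (forall b, b \in B -> 1 <= b <= N%:Z) ->
    (0 < #|` A|)%N -> (0 < #|` B|)%N -> config_free P N A B ->
    (256 * l * N ^ 2 <= r * (#|` A| * #|` B|))%N ->
    (N < (E * r.+1) ^ (E * r.+1 ^ 2))%N.
Proof.
move=> l0 k0 P0 Pk; set Cs := (coef_sum P k).+1.
(* Error [1 / m] on monomials becomes at most [1 / (2 * l)] on the [P i], as [common_shifts]
   demands. *)
pose m := (2 * l * Cs)%N.
have m0 : (0 < m)%N by rewrite !muln_gt0 l0.
have [E [E0 rec]] := recurrence R k0 m0.
exists (E * k + Cs)%N; split=> [|N A B r hA hB A0 B0 cf large]; first by rewrite addnS.
set D := ((E * r.+1) ^ (E * r.+1 ^ 2))%N.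
(* For larger [N] all [P i] are bounded by [N] at [d <= D], as the transfer to integers requires. *)
suff : (N < Cs * D ^ k)%N.
  move=> /leq_trans; apply; rewrite /D -expnM; set F := (E * k + Cs)%N.
  have F0 : (0 < F)%N by rewrite /F addnS.
  have -> : (F * r.+1 ^ 2 = Cs * r.+1 ^ 2 + E * r.+1 ^ 2 * k)%N by rewrite /F; ring.
  rewrite expnD leq_mul //.
    apply: leq_trans (_ : F * r.+1 <= _)%N; first by rewrite /F; nia.
    by rewrite -{1}[(_ * r.+1)%N]expn1 leq_pexp2l ?muln_gt0 ?expn_gt0 ?F0.
  rewrite leq_exp2r ?muln_gt0 ?E0 ?k0 ?expn_gt0 // leq_mul2r /F; nia.
rewrite ltnNge; apply/negP => CN.
have N0 : (0 < N)%N.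
  by have := A0; rewrite cardfs_gt0 => /fset0Pn[a /hA]; lia.
have [p pN] : exists p, p.+2 = (4 * N)%N by exists (4 * N - 2)%N; lia.
have [chi [D_chi u_chi o_chi]] := exists_character R p.
pose A' := residues p A; pose B' := residues p B.
have cA : #|A'| = #|` A| by apply: card_residues => a /hA; lia.
have cB : #|B'| = #|` B| by apply: card_residues => b /hB; lia.
pose eta : R := #|A'|%:R ^+ 2 * #|B'|%:R / (16 * l%:R * #|{: 'I_p.+2}|%:R).
pose S := spectrum chi A' eta.
(* With [4 * N] residues, Parseval bounds the spectrum by [16 * l * (4 * N) ^ 2 / (|A||B|)]; hence
   the constant 256. *)
have Sr : (#|S| <= r)%N.
  have := card_spectrum D_chi u_chi o_chi A' eta.
  rewrite -/S /eta cA cB card_ord pN mulrA.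
  rewrite ler_pdivrMr ?mulr_gt0 ?ltr0n ?muln_gt0 ?N0 //.
  rewrite -!natrX -!natrM ler_nat => le.
  rewrite -(leq_pmul2r (_ : 0 < #|` A| * #|` B|)%N) ?muln_gt0 ?A0 //.
  apply: leq_trans large; rewrite -(leq_pmul2r A0); nia.
pose z (s : 'I_#|S|) := chi (enum_val s).
have SD : ((E * #|S|.+1) ^ (E * #|S|.+1 ^ 2) <= D)%N.
  apply: leq_trans (_ : (E * r.+1) ^ (E * #|S|.+1 ^ 2) <= _)%N.
    by rewrite leq_exp2r ?muln_gt0 ?E0 ?expn_gt0 // leq_mul2l ltnS Sr orbT.
  by rewrite leq_pexp2l ?muln_gt0 ?E0 // leq_mul2l leq_exp2r // ltnS Sr orbT.
have [d [/andP[d0 dD] dP]] := rec _ z D (fun s => u_chi _) SD.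
pose t i := (P i).[d%:Z].
have tN i : `|t i| <= N%:Z.
  apply: le_trans (poly_eval_bound P0 Pk i d0) _; rewrite lez_nat.
  apply: leq_trans CN; rewrite leq_mul //.
  by rewrite leq_exp2r.
have A'0 : A' != set0 by rewrite -card_gt0 cA.
have B'0 : B' != set0 by rewrite -card_gt0 cB.
have [|x [fx ft]] := common_shifts D_chi u_chi o_chi (t := fun i => (t i)%:~R) l0 A'0 B'0.
  move=> xi i xiS; rewrite character_intz //.
  have mR : 0 < m%:R :> R by rewrite ltr0n.
  have near j : (j < k)%N -> udist (chi xi ^+ (d ^ j.+1)) <= m%:R^-1.
    move=> jk; rewrite -[X in _ <= X]mul1r ler_pdivlMr //.
    by have := dP (enum_rank_in xiS xi) j jk; rewrite /z enum_rankK_in.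
  have m_ge0 : 0 <= m%:R^-1 :> R by rewrite invr_ge0.
  have le := udist_poly_eval P0 Pk i (u_chi xi) m_ge0 near.
  apply: le_trans (ler_wpM2r _ le) _; first by rewrite mulr_ge0.
  rewrite mulrAC ler_pdivrMr // mul1r -!natrM ler_nat /m mulnC leq_mul2l.
  by rewrite leqnSn orbT.
have [c cN cAB] := sumset_of_residues hA hB pN tN fx ft.
have dnz : d%:Z != 0 by rewrite eqz_nat -lt0n.
exact: not_config_free cf dnz cN cAB.
Qed.
End Core.

(** * The quantitative bound *)

Section Endgame.
Variable R : realType.

(** From [exp (1/6) <= 6/5] and [(6/5) ^ 6 < 3]; it makes [ln (ln N)] positive from [N = 3] on. *)
Lemma ln3_gt1 : 1 < ln 3 :> R.
Proof.
rewrite -ltr_expR lnK ?posrE //.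
have inv : 5 / 6 <= expR (- (1 / 6)) :> R.
  by apply: (le_trans _ (expR_ge1Dx _)); lra.
have e6 : expR (1 / 6) <= 6 / 5 :> R.
  have -> : expR (1 / 6) = (expR (- (1 / 6)))^-1 :> R by rewrite -expRN opprK.
  have -> : 6 / 5 = (5 / 6)^-1 :> R by field.
  by rewrite lef_pV2 ?posrE ?expR_gt0 ?divr_gt0.
have -> : expR 1 = expR (1 / 6) ^+ 6 :> R by rewrite -expRM_natl; congr expR; field.
apply: le_lt_trans (_ : (6 / 5) ^+ 6 < _); last by lra.
by rewrite lerXn2r ?nnegrE ?expR_ge0 ?divr_ge0.
Qed.

Let c3 : R := ln (ln 3).

Lemma c3_gt0 : 0 < c3.
Proof. exact/ln_gt0/ln3_gt1. Qed.

Lemma lnln_bounds (N : nat) : (3 <= N)%N ->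
  [/\ 1 < ln (N%:R : R), c3 <= ln (ln (N%:R : R)) & ln (ln (N%:R : R)) < ln (N%:R : R)].
Proof.
move=> N3; have ln3 := ln3_gt1.
have lnN : ln 3 <= ln (N%:R : R) by rewrite ler_ln ?posrE ?ltr0n ?ler_nat //; lia.
split; first exact: lt_le_trans lnN.
  by rewrite ler_ln ?posrE //; lra.
by apply: ln_sublinear; lra.
Qed.

(** Up to constants, [L <= r ^ 2 ln r] and [al <= 1 / r]. If [al] exceeded the bound, [r] would be
    at most about the square root of [L / u], so that [ln r] is bounded by a multiple of [u];
    inserted into the first inequality, this contradicts the assumed size of [al]. *)
Lemma density_le_sqrt (E l r N : nat) (al : R) : (0 < E)%N -> (0 < l)%N -> (3 <= N)%N ->
  0 < al -> r.+1%:R * al <= 258 * l%:R -> (N < (E * r.+1) ^ (E * r.+1 ^ 2))%N ->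
  al <= E%:R * (258 * l%:R) * (1 + `|ln c3| / c3) *
        Num.sqrt (ln (ln (N%:R : R)) / ln (N%:R : R)).
Proof.
move=> E0 l0 N3 al0 ral NE; have c0 := c3_gt0.
have [L1 uc uL] := lnln_bounds N3.
set L := ln (N%:R : R) in L1 uc uL *; set u := ln L in uc uL *.
set q : R := `|ln c3| / c3; set F : R := 258 * l%:R.
have q0 : 0 <= q by rewrite divr_ge0 // ltW.
have E1 : 1 <= E%:R :> R by rewrite ler1n.
have F0 : 0 < F by rewrite mulr_gt0 ?ltr0n.
have u0 : 0 < u by lra.
rewrite leNgt; apply/negP => big.
set C := E%:R * F * (1 + q) in big.
have E0R : 0 < E%:R :> R by rewrite ltr0n.
have q1 : 0 < 1 + q by lra.
have C0 : 0 < C by exact: mulr_gt0 (mulr_gt0 E0R F0) q1.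
have y0 : 0 <= u / L by rewrite divr_ge0 //; lra.
have big2 : C ^+ 2 * u < al ^+ 2 * L.
  have : C ^+ 2 * (u / L) < al ^+ 2.
    rewrite -[X in _ * X < _](sqr_sqrtr y0) -exprMn ltr_pXn2r // nnegrE.
      by rewrite mulr_ge0 ?sqrtr_ge0 // ltW.
    exact: ltW.
  by rewrite mulrA ltr_pdivrMr //; lra.
set r1 : R := r.+1%:R in ral; have r10 : 0 < r1 by rewrite ltr0n.
pose w := ln (E%:R * r1).
have w0 : 0 <= w by apply: ln_ge0; rewrite -natrM ler1n muln_gt0 E0.
have Lw : L <= E%:R * r1 ^+ 2 * w.
  have -> : E%:R * r1 ^+ 2 * w = ln (((E * r.+1) ^ (E * r.+1 ^ 2))%N%:R : R).
    by rewrite natrX lnXn ?ltr0n ?muln_gt0 ?E0 // -[RHS]mulr_natl /w natrM natrX natrM.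
  have N0 : (0 < N)%N by apply: leq_trans N3.
  by rewrite ler_ln ?posrE ?ltr0n ?(leq_trans _ NE) // ler_nat ltnW.
have ral2 : r1 ^+ 2 * al ^+ 2 <= F ^+ 2.
  by rewrite -exprMn lerXn2r ?nnegrE ?mulr_ge0 // ltW.
have uw : C ^+ 2 * u < E%:R * F ^+ 2 * w.
  apply: lt_le_trans big2 _.
  apply: le_trans (ler_wpM2l (sqr_ge0 al) Lw) _.
  have -> : al ^+ 2 * (E%:R * r1 ^+ 2 * w) = E%:R * w * (r1 ^+ 2 * al ^+ 2) by ring.
  have -> : E%:R * F ^+ 2 * w = E%:R * w * F ^+ 2 by ring.
  by rewrite ler_wpM2l // mulr_ge0.
(* The term [- ln u] is absorbed into [q * u] because [u >= c3]; this is the origin of [1 + q]. *)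
have w_le : 2 * w <= u * (1 + q).
  have -> : 2 * w = ln ((E%:R * r1) ^+ 2).
    by rewrite lnXn ?mulr_gt0 ?ltr0n // mulr_natl.
  apply: le_trans (_ : ln (L / u) <= _).
    rewrite ler_ln ?posrE ?exprn_gt0 ?divr_gt0 ?mulr_gt0 ?ltr0n //; last by lra.
    rewrite ler_pdivlMr // -(ler_pM2r (exprn_gt0 2 al0)).
    have : (E%:R * r1) ^+ 2 * al ^+ 2 <= C ^+ 2.
      have le : E%:R * r1 * al <= C.
        rewrite -mulrA; apply: le_trans (ler_wpM2l (ltW E0R) ral) _.
        by rewrite /C ler_peMr ?lerDl // ltW // mulr_gt0.
      rewrite -exprMn lerXn2r ?nnegrE ?(ltW C0) //.
      by apply: ltW; rewrite !mulr_gt0.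
    move=> le; apply: le_trans (_ : C ^+ 2 * u <= _); first by rewrite mulrAC ler_wpM2r // ltW.
    by rewrite mulrC; apply: ltW; rewrite mulrC [L * _]mulrC.
  rewrite ln_div ?posrE //; last by lra.
  rewrite -/u mulrDr mulr1 lerD2l.
  have lnc : ln c3 <= ln u by rewrite ler_ln ?posrE.
  apply: le_trans (_ : `|ln c3| <= _).
    by have := ler_norm (- ln c3); rewrite normrN; lra.
  rewrite /q mulrCA ler_peMr // ler_pdivlMr // mul1r //.
have : C ^+ 2 * u < E%:R * F ^+ 2 * (u * (1 + q)).
  apply: lt_le_trans uw _; rewrite ler_wpM2l ?mulr_ge0 ?sqr_ge0 //; lra.
apply/negP; rewrite -leNgt.
have -> : C ^+ 2 * u = E%:R * F ^+ 2 * (u * (1 + q)) * (E%:R * (1 + q)) by rewrite /C; ring.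
rewrite ler_peMr ?mulr_ge0 ?sqr_ge0 ?(ltW u0) //; first by lra.
nra.
Qed.
End Endgame.

Lemma card_interval (A : {fset int}) (lo : int) (n : nat) :
  (forall a : int, a \in A -> lo < a <= lo + n%:Z) -> (#|` A| <= n)%N.
Proof.
move=> hA; rewrite -(size_iota 0 n) -(size_map (fun i : nat => lo + i.+1%:Z)).
apply: uniq_leq_size; first exact: fset_uniq.
move=> a /hA a_bd; apply/mapP; exists (absz (a - lo - 1)%R); last by lia.
by rewrite mem_iota; lia.
Qed.

Lemma exists_large (A : {fset int}) (N : nat) :
  (forall a : int, a \in A -> 1 <= a <= N%:Z) -> (0 < #|` A|)%N ->
  exists2 a, a \in A & #|` A|%:Z <= a.
Proof.
move=> hA A0; have [/hasP[a aA le]|/hasPn no] := boolP (has (fun a => #|` A|%:Z <= a) A).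
  by exists a.
have /card_interval : forall a : int, a \in A -> 0 < a <= 0 + #|` A|.-1%:Z.
  by move=> a aA; have := no a aA; rewrite -ltNge => lt; have := hA a aA; lia.
by rewrite leqNgt prednK // leqnn.
Qed.

Lemma exists_small (A : {fset int}) (N : nat) :
  (forall a : int, a \in A -> 1 <= a <= N%:Z) -> (0 < #|` A|)%N ->
  exists2 a, a \in A & a <= N%:Z + 1 - #|` A|%:Z.
Proof.
move=> hA A0; have [/hasP[a aA le]|/hasPn no] := boolP (has (fun a => a <= N%:Z + 1 - #|` A|%:Z) A).
  by exists a.
have /card_interval : forall a : int, a \in A ->
    N%:Z + 1 - #|` A|%:Z < a <= N%:Z + 1 - #|` A|%:Z + #|` A|.-1%:Z.
  by move=> a aA; have := no a aA; rewrite -ltNge => lt; have := hA a aA; lia.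
by rewrite leqNgt prednK // leqnn.
Qed.

(** For [t >= 0] take large elements, [a >= |A|] and [b >= |B|], so that [a + b - t >= 2]; for
    [t < 0] take small ones to stay below [2 * N]. *)
Lemma translated_sum (A B : {fset int}) (N : nat) (t : int) :
  (forall a : int, a \in A -> 1 <= a <= N%:Z) -> (forall b : int, b \in B -> 1 <= b <= N%:Z) ->
  (0 < #|` A|)%N -> (0 < #|` B|)%N -> (`|t| + 2 <= #|` A| + #|` B|)%N ->
  exists2 m, 2 <= m <= (2 * N)%N%:Z & m + t \in sumset A B.
Proof.
move=> hA hB A0 B0 le; have [t0|t0] := lerP 0 t.
  have [[a aA la] [b bB lb]] := (exists_large hA A0, exists_large hB B0).
  exists (a + b - t); last by rewrite subrK; apply: in_imfset2.
  by have := hA a aA; have := hB b bB; lia.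
have [[a aA la] [b bB lb]] := (exists_small hA A0, exists_small hB B0).
exists (a + b - t); last by rewrite subrK; apply: in_imfset2.
by have := hA a aA; have := hB b bB; lia.
Qed.

Theorem corollary2 (R : realType) (l : nat) (hl : (1 <= l)%N)
    (P : 'I_l -> {poly int}) (hP0 : forall i : 'I_l, (P i).[0] = 0)
    (k : nat) (hk : k = max_degree P) (hk2 : (2 <= k)%N) :
  exists C' : R, 0 < C' /\
    forall N : nat, (3 <= N)%N ->
    forall A B : {fset int},
      (forall a : int, a \in A -> 1 <= a <= N%:Z) ->
      (forall b : int, b \in B -> 1 <= b <= N%:Z) ->
      ~ (exists d m : int,
           [/\ d != 0, 2 <= m <= (2 * N)%N%:Z &
               translate m (poly_values P d) `<=` sumset A B]) ->
      #|` A|%:R * #|` B|%:R / N%:R ^+ 2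
        <= C' * (ln (ln (N%:R : R)) / ln (N%:R : R))
                `^ (1 / (l * (k - 1))%N%:R).
Proof.
have k0 : (0 < k)%N by apply: leq_trans hk2.
have Pk i : (size (P i) <= k.+1)%N.
  have : ((size (P i)).-1 <= k)%N.
    by rewrite hk /max_degree (bigD1 i) //= leq_maxl.
  by case: (size _).
have c3 := c3_gt0 R.
have n0 : (0 < l * (k - 1))%N by rewrite muln_gt0 hl subn_gt0.
have y_bd (N : nat) : (3 <= N)%N -> 0 < ln (ln (N%:R : R)) / ln (N%:R : R) < 1.
  case/(lnln_bounds R) => L1 u1 uL.
  rewrite divr_gt0 /= ?ltr_pdivrMr ?mul1r //; lra.
have empty (N : nat) (A B : {fset int}) (C e : R) : 0 < C ->
    (#|` A| == 0)%N || (#|` B| == 0)%N ->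
    #|` A|%:R * #|` B|%:R / N%:R ^+ 2 <= C * (ln (ln (N%:R : R)) / ln (N%:R : R)) `^ e.
  move=> C0 /orP[] /eqP ->; rewrite ?mul0r ?mulr0 ?mul0r mulr_ge0 ?powR_ge0 ?ltW //.
(* The recurrence argument gives the exponent 1/2, which suffices unless [l = 1]
   and [k = 2]; for a single polynomial a translate of one sum is enough. *)
have [n1|n2] := leqP (l * (k - 1)) 1.
  have l1 : l = 1%N by nia.
  pose t := (P (Ordinal hl)).[1].
  exists ((`|t| + 2)%N%:R ^+ 2 / ln (ln 3)); split.
    by rewrite divr_gt0 // exprn_gt0 // ltr0n addn2.
  move=> N N3 A B hA hB cf.
  have [e|] := boolP ((#|` A| == 0)%N || (#|` B| == 0)%N).
    by apply: empty e; rewrite divr_gt0 // exprn_gt0 // ltr0n addn2.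
  rewrite negb_or -!lt0n => /andP[A0 B0].
  have -> : (l * (k - 1))%N = 1%N by lia.
  have /andP[y0 _] := y_bd N N3; rewrite divr1 powRr1 ?(ltW y0) //.
  (* Already [d = 1] gives a configuration if [A] and [B] have too many elements, so their sizes are
     bounded independently of [N]. *)
  have small : (#|` A| + #|` B| <= `|t| + 2)%N.
    rewrite leqNgt; apply/negP => big; apply: cf.
    have [m mN mt] := translated_sum hA hB A0 B0 (ltnW big).
    exists 1, m; split=> //; apply/fsubsetP => x /imfsetP[v /= /imfsetP[i /= _ ->] ->].
    suff -> : i = Ordinal hl by [].
    by apply: val_inj => /=; have := ltn_ord i; rewrite {2}l1; case: (nat_of_ord i).
  have [L1 uc uL] := lnln_bounds R N3; set u := ln (ln (N%:R : R)) in uc uL *.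
  have N0 : 0 < N%:R :> R by rewrite ltr0n; apply: leq_trans N3.
  have LN : ln (N%:R : R) < N%:R by apply: ln_sublinear.
  set L := ln N%:R in L1 uL LN *; set T : R := (`|t| + 2)%N%:R ^+ 2.
  have T0 : 0 <= T by rewrite exprn_ge0.
  have AB : #|` A|%:R * #|` B|%:R <= T.
    by rewrite /T expr2 ler_pM // ler_nat (leq_trans _ small) // ?leq_addr ?leq_addl.
  have N1 : 1 <= N%:R :> R by rewrite ler1n; apply: leq_trans N3.
  rewrite ler_pdivrMr ?exprn_gt0 //; apply: le_trans AB _.
  have key : ln (ln 3) <= u / L * N%:R ^+ 2.
    apply: (le_trans uc); rewrite mulrAC ler_pdivlMr; last lra.
    apply: ler_wpM2l; first exact: ltW (lt_le_trans c3 uc).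
    by rewrite (le_trans (ltW LN)) // expr2 ler_peMr // ltW.
  rewrite -mulrA mulrAC ler_pdivlMr //.
  by rewrite ler_wpM2l.
have [E [E0 core]] := config_free_bound R hl k0 hP0 Pk.
pose c := ln (ln 3) : R.
have C0 : 0 < E%:R * (258 * l%:R) * (1 + `|ln c| / c) :> R.
  rewrite !mulr_gt0 ?ltr0n // ltr_wpDr // divr_ge0 // ltW //.
eexists; split; first exact: C0.
move=> N N3 A B hA hB cf.
have [e|] := boolP ((#|` A| == 0)%N || (#|` B| == 0)%N); first exact: empty.
rewrite negb_or -!lt0n => /andP[A0 B0].
have /andP[y0 y1] := y_bd N N3; set y := _ / _ in y0 y1 *.
pose al : R := #|` A|%:R * #|` B|%:R / N%:R ^+ 2.
have N0 : (0 < N)%N by apply: leq_trans N3.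
have N2 : 0 < N%:R ^+ 2 :> R by rewrite exprn_gt0 // ltr0n.
have AB0 : (0 < #|` A| * #|` B|)%N by rewrite muln_gt0 A0.
have al0 : 0 < al by rewrite divr_gt0 // -natrM ltr0n.
have cardN (S : {fset int}) : (forall a : int, a \in S -> 1 <= a <= N%:Z) -> (#|` S| <= N)%N.
  by move=> hS; apply: (@card_interval S 0) => a /hS; lia.
pose r := (256 * l * N ^ 2 %/ (#|` A| * #|` B|)).+1.
have r_large : (256 * l * N ^ 2 <= r * (#|` A| * #|` B|))%N by rewrite ltnW // ltn_ceil.
(* [r.+1] exceeds the exact quotient by at most 2, and [|A||B| <= N ^ 2]; hence 258 = 256 + 2. *)
have r_small : r.+1%:R * al <= 258 * l%:R.
  rewrite /al mulrA ler_pdivrMr // -natrX -!natrM ler_nat.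
  have AB : (#|` A| * #|` B| <= N * N)%N by rewrite leq_mul ?cardN.
  have := leq_divM (256 * l * N ^ 2) (#|` A| * #|` B|).
  rewrite /r; move: (_ %/ _)%N AB => w; move: (_ * _)%N => ab ab_le le.
  rewrite -mulnn in le *; nia.
apply: le_trans (density_le_sqrt E0 hl N3 al0 r_small (core _ _ _ _ hA hB A0 B0 cf r_large)) _.
rewrite -/y -/c ler_wpM2l ?(ltW C0) // -powR12_sqrt ?(ltW y0) //.
apply: ger_powR; first by rewrite y0 ltW.
by rewrite div1r lef_pV2 ?posrE ?ltr0n // ler_nat.
Qed.
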